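(* Let $\varphi,\psi$ be two fixed functions in $L^2(\mathbb{R})$. Then there exists an integer $N=N(\varphi,\psi)$, depending only on $\varphi$ and $\psi$, such that, if $(e_k)_{k\in I}\subset L^2(\mathbb{R})$ is an orthonormal family satisfying, for all $k\in I$, $$ |e_k|\leq \varphi\quad\text{and}\quad |\widehat{e_k}|\leq \psi $$ almost everywhere on $\mathbb{R}$, then the index set $I$ has at most $N$ elements.
   Context: The Fourier transform is $\widehat{f}(\xi)=\int_{\mathbb{R}} f(x)e^{-2i\pi x\xi}\,dx$ for $f\in L^1(\mathbb{R})\cap L^2(\mathbb{R})$, extended to $L^2(\mathbb{R})$ as usual. *)

(* Defs.v *)
From HB Require Import structures.
From mathcomp Require Export all_boot all_order all_algebra.
From mathcomp Require Export all_classical all_reals all_analysis.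
From mathcomp Require Export complex.

Set Implicit Arguments.
Unset Strict Implicit.
Unset Printing Implicit Defensive.

Import Order.TTheory GRing.Theory Num.Theory.
Import ComplexField.Normc.
Import numFieldNormedType.Exports.

Local Open Scope classical_set_scope.
Local Open Scope ring_scope.

Section L2_and_Fourier.
Variable R : realType.
Implicit Types f g : R -> R[i].

Local Notation mu := (@lebesgue_measure R).
Local Notation Re := (@complex.Re R).
Local Notation Im := (@complex.Im R).

Definition cexpi (t : R) : R[i] := (cos t +i* sin t)%C.

(** Functions, not classes modulo a.e. equality: "f is a representative of an
    element of L^p(R; C)". *)
Definition Lcfun (p : \bar R) f : Prop :=
  Re \o f \in Lfun mu p /\ Im \o f \in Lfun mu p.

Definition cintegral f : R[i] :=
  ((\int[mu]_x Re (f x)) +i* (\int[mu]_x Im (f x)))%C.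

Definition cdot f g : R[i] := cintegral (fun x => f x * (g x)^*%C).

Definition L2dist f g : \bar R := 'N[mu]_2%:E[(fun x => (normc (f x - g x))%:E)]%E.

Definition orthonormal_family (I : Type) (e : I -> R -> R[i]) : Prop :=
  (forall k, cdot (e k) (e k) = 1) /\
  (forall j k, j <> k -> cdot (e j) (e k) = 0).

(** Meaningful for integrable [f]. *)
Definition fourier f (xi : R) : R[i] :=
  cintegral (fun x => f x * cexpi (- (2 * pi * x * xi))).

(** The graph of the Fourier transform on L^2(R), i.e. of the extension of
    [fourier] from L^1 /\ L^2 by density; [g] is thus determined by [f] up to
    a.e. equality. *)
Definition fourierL2 f g : Prop :=
  [/\ Lcfun 2%:E f, Lcfun 2%:E g &
   exists u : nat -> R -> R[i],
   [/\ forall n, Lcfun 1%:E (u n) /\ Lcfun 2%:E (u n),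
       L2dist (u n) f @[n --> \oo] --> 0%E &
       L2dist (fourier (u n)) g @[n --> \oo] --> 0%E]].

End L2_and_Fourier.

(* Main.v *)
(* Everything is reduced to the Hartley transform, the real analogue of the
   Fourier transform with kernel cos + sin: it is real and symmetric, and the
   Hartley transforms of Re f and Im f are combinations of the Fourier transform
   of f at y and -y. Thus |F e_k| <= psi bounds both of them by psi(y) + psi(-y).

   Band-limit e_k to frequencies in [-M, M], obtaining s_k. Since psi is in L^2,
   s_k is close to e_k uniformly in k for M large; since phi is in L^2, most of
   the mass of e_k lies in [-r, r] for r large; so the integral of |s_k|^2 over
   [-r, r] is at least 1/4. On the other hand s_k(x) is the inner product of e_k
   with a kernel K_x of squared norm O(M), so Bessel's inequality bounds the sum
   over k of |s_k(x)|^2 by O(M), and integrating over [-r, r] bounds the number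
   of indices by O(M r).

   Plancherel's theorem is only needed up to constants. The inequality
   |H v| <= |v| follows by inserting the weight exp(-2 pi a |y|), whose transform
   is the Poisson kernel, and letting a tend to 0. The reverse direction is
   proved first for integrals over intervals and then, by Lebesgue's
   differentiation theorem, for the functions themselves. *)

Require Import Defs.
From mathcomp Require Import measurable_realfun ring lra.
Local Open Scope classical_set_scope.
Local Open Scope ring_scope.
Local Open Scope card_scope.
Import ComplexField.Normc.

Set Implicit Arguments.
Unset Strict Implicit.
Unset Printing Implicit Defensive.
Import Order.TTheory GRing.Theory Num.Theory.
Import numFieldNormedType.Exports.

(** * Square-integrable functions *)

Section square_integrable.
Context d (T : measurableType d) (R : realType).
Variable mu : {measure set T -> \bar R}.
Local Notation L1 f := (mu.-integrable [set: T] (EFin \o f)).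
Implicit Types f g m : T -> R.

Lemma integrable_measurableT f : L1 f -> measurable_fun setT f.
Proof. by move=> /measurable_int/measurable_EFinP. Qed.

Lemma le_integrableT f g : measurable_fun setT f ->
  (forall x, `|f x| <= g x) -> L1 g -> L1 f.
Proof.
move=> mf fg; apply: le_integrable => //; first exact/measurable_EFinP.
by move=> x _ /=; rewrite lee_fin (le_trans (fg x))// ler_norm.
Qed.

Lemma integrableDT f g : L1 f -> L1 g -> L1 (fun x => f x + g x).
Proof. by move=> f1 g1; have := @integrableD _ _ _ mu _ measurableT _ _ f1 g1. Qed.

Lemma integrableBT f g : L1 f -> L1 g -> L1 (fun x => f x - g x).
Proof. by move=> f1 g1; have := @integrableB _ _ _ mu _ measurableT _ _ f1 g1. Qed.

Lemma integrableZT c f : L1 f -> L1 (fun x => c * f x).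
Proof. by move=> f1; have := @integrableZl _ _ _ mu _ measurableT c _ f1. Qed.

Lemma integrableMbT f m C : L1 f -> measurable_fun setT m ->
  (forall x, `|m x| <= C) -> L1 (fun x => f x * m x).
Proof.
move=> f1 mm mC.
apply: (@le_integrableT _ (fun x => C * `|f x|)).
- by apply: measurable_funM => //; exact: integrable_measurableT.
- by move=> x; rewrite normrM mulrC ler_wpM2r.
- apply: integrableZT; exact: integrable_norm.
Qed.

Lemma ge0_bounded_integrable f (C : R) : measurable_fun setT f ->
  (forall x, 0 <= f x) -> (\int[mu]_x (f x)%:E <= C%:E)%E ->
  L1 f /\ \int[mu]_x f x <= C.
Proof.
move=> mf f0 fC; have f1 : L1 f.
  apply/integrableP; split; first exact/measurable_EFinP.
  under eq_integral do rewrite /= ger0_norm//.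
  by rewrite (le_lt_trans fC)// ltry.
by split=> //; rewrite -lee_fin /Rintegral fineK//; exact: integrable_fin_num.
Qed.

Lemma EFin_RintegralT f : L1 f -> (\int[mu]_x f x)%:E = (\int[mu]_x (f x)%:E)%E.
Proof. by move=> f1; rewrite /Rintegral fineK//; exact: integrable_fin_num. Qed.

(** Fatou's lemma with integrability of the limit as part of the conclusion; this is how Hartley
    transforms are shown to be square integrable. *)
Lemma Rintegral_fatou (g : nat -> T -> R) f (C : R) :
  (forall n, L1 (g n)) -> (forall n x, 0 <= g n x) ->
  measurable_fun setT f -> (forall x, 0 <= f x) ->
  {ae mu, forall x, g n x @[n --> \oo] --> f x} ->
  (forall n, \int[mu]_x g n x <= C) ->
  L1 f /\ \int[mu]_x f x <= C.
Proof.
move=> g1 g0 mf f0 gf gC.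
apply: ge0_bounded_integrable => //.
have mg n : measurable_fun setT (fun x => (g n x)%:E).
  exact: (measurable_int mu (g1 n)).
have -> : (\int[mu]_x (f x)%:E = \int[mu]_x limn_einf (fun n => (g n x)%:E))%E.
  apply: ae_eq_integral => //.
  - exact/measurable_EFinP.
  (* Measurability of the lower limit is drawn from that of the upper limit of the negatives. *)
  - rewrite [X in measurable_fun _ X](_ : _ =
        -%E \o (fun x => limn_esup (fun n => - (g n x)%:E)%E)); last first.
      apply/funext => x /=; rewrite -limn_einfN; congr limn_einf.
      by apply/funext => n /=; rewrite opprK.
    apply: measurableT_comp => //; apply: measurable_fun_limn_esup => n.
    exact: measurableT_comp.
  - apply: filterS gf => x gfx _; apply/esym; rewrite is_cvg_limn_einfE; last first.
      by apply/cvg_ex; exists (f x)%:E; apply: cvg_EFin => //; exact: nearW.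
    by apply/cvg_lim => //; apply: cvg_EFin => //; exact: nearW.
apply: (le_trans (fatou mu measurableT mg _)); first by move=> n x _; rewrite lee_fin.
rewrite limn_einf_lim; apply: lime_le; first exact: is_cvg_einfs.
apply: nearW => n; apply: ereal_inf_le; exists (\int[mu]_x (g n x)%:E)%E; first by exists n => /=.
by rewrite -EFin_RintegralT// lee_fin.
Qed.

Lemma Rintegral_dominated_cvg (g : nat -> T -> R) f h :
  (forall n, measurable_fun setT (g n)) -> measurable_fun setT f ->
  {ae mu, forall x, g n x @[n --> \oo] --> f x} -> L1 h ->
  (forall n x, `|g n x| <= h x) ->
  \int[mu]_x g n x @[n --> \oo] --> \int[mu]_x f x.
Proof.
move=> mg mf gf h1 gh.
have g1 n : L1 (g n) by apply: le_integrableT h1.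
have gfE : {ae mu, forall x, setT x -> (g n x)%:E @[n --> \oo] --> (f x)%:E}.
  by apply: filterS gf => x gfx _; apply: cvg_EFin => //; exact: nearW.
have ghE : {ae mu, forall x n, setT x -> (`|(g n x)%:E| <= (h x)%:E)%E}.
  by apply: filterE => x n _; rewrite lee_fin.
have mgE n : measurable_fun setT (fun x => (g n x)%:E) by exact/measurable_EFinP.
have mfE : measurable_fun setT (EFin \o f) by exact/measurable_EFinP.
have [f1 _ cv] := dominated_convergence measurableT mgE mfE gfE h1 ghE.
by apply: fine_cvg; rewrite EFin_RintegralT.
Qed.

(** Measurability of [f] is stated apart because that of [f ^+ 2] does not imply it. *)
Definition sqint f := measurable_fun setT f /\ L1 (fun x => f x ^+ 2).

Lemma sqintM f g : sqint f -> sqint g -> L1 (fun x => f x * g x).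
Proof.
move=> [mf f2] [mg g2]; apply: (le_integrableT _ _ (integrableDT f2 g2)).
  exact: measurable_funM.
move=> x; rewrite normrM -(real_normK (num_real (f x))) -(real_normK (num_real (g x))).
have := sqr_ge0 (`|f x| - `|g x|); have := normr_ge0 (f x); have := normr_ge0 (g x); nra.
Qed.

Lemma sqintMb f m C : sqint f -> measurable_fun setT m ->
  (forall x, `|m x| <= C) -> sqint (fun x => f x * m x).
Proof.
move=> [mf f2] mm mC; split; first exact: measurable_funM.
under eq_fun do rewrite exprMn.
apply: (@integrableMbT _ _ (C ^+ 2)) => //; first exact: measurable_funX.
by move=> x; rewrite normrX lerXn2r ?nnegrE// (le_trans _ (mC x)).
Qed.

Lemma sqintZ c f : sqint f -> sqint (fun x => c * f x).
Proof.
move=> f2; under eq_fun do rewrite mulrC.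
by apply: (@sqintMb _ (cst c) `|c|).
Qed.

Lemma sqintD f g : sqint f -> sqint g -> sqint (fun x => f x + g x).
Proof.
move=> f2 g2; split; first by apply: measurable_funD; [case: f2|case: g2].
under eq_fun do rewrite sqrrD.
apply: integrableDT; last by case: g2.
apply: integrableDT; first by case: f2.
have := integrableZT 2 (sqintM f2 g2).
by apply: eq_integrable => // x _ /=; rewrite mulr_natl.
Qed.

Lemma sqintB f g : sqint f -> sqint g -> sqint (fun x => f x - g x).
Proof.
move=> f2 /(sqintZ (-1)) g2; have := sqintD f2 g2.
by under eq_fun do rewrite mulN1r.
Qed.

Lemma Rintegral_sqr_ge0 f : 0 <= \int[mu]_x f x ^+ 2.
Proof. by apply: Rintegral_ge0 => x _; exact: sqr_ge0. Qed.

Lemma Rintegral_sqrBZ f g t : sqint f -> sqint g ->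
  \int[mu]_x (f x - t * g x) ^+ 2 =
  \int[mu]_x f x ^+ 2 - 2 * t * \int[mu]_x (f x * g x) + t ^+ 2 * \int[mu]_x g x ^+ 2.
Proof.
move=> f2 g2; have fg := sqintM f2 g2; case: (f2) (g2) => [_ f1] [_ g1].
rewrite -RintegralZl// -RintegralZl// -RintegralB//; last exact: integrableZT.
rewrite -RintegralD//.
- by apply: eq_Rintegral => x _; ring.
- by apply: integrableBT => //; exact: integrableZT.
- exact: integrableZT.
Qed.

(** The integral of [(f - t g) ^+ 2] is a polynomial in [t] of degree at most 2 that is nowhere
    negative. *)
Lemma Rintegral_CauchySchwarz f g : sqint f -> sqint g ->
  (\int[mu]_x (f x * g x)) ^+ 2 <= \int[mu]_x f x ^+ 2 * \int[mu]_x g x ^+ 2.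
Proof.
move=> f2 g2.
set a := \int[mu]_x f x ^+ 2; set c := \int[mu]_x g x ^+ 2.
set b := \int[mu]_x (f x * g x).
have key t : 0 <= a - 2 * t * b + t ^+ 2 * c.
  by rewrite -Rintegral_sqrBZ// Rintegral_sqr_ge0.
have a0 : 0 <= a := Rintegral_sqr_ge0 f.
have : 0 <= c := Rintegral_sqr_ge0 g.
rewrite le_eqVlt => /predU1P[c0|c0].
  have [b0|b0] := eqVneq b 0; first by rewrite b0 expr0n /= mulr_ge0// -c0.
  (* With [c = 0] the polynomial is affine in [t], and this [t] would give it the value -1. *)
  have := key ((a + 1) / (2 * b)); rewrite -c0 mulr0 addr0.
  have -> : 2 * ((a + 1) / (2 * b)) * b = a + 1 by field.
  by rewrite opprD addrA subrr sub0r oppr_ge0 ler10.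
(* The minimiser of the quadratic. *)
have := key (b / c).
have -> : a - 2 * (b / c) * b + (b / c) ^+ 2 * c = (a * c - b ^+ 2) / c.
  by field; rewrite gt_eqF.
by rewrite pmulr_lge0 ?invr_gt0// subr_ge0.
Qed.

(** Strong convergence in L^2 implies weak convergence, by Cauchy-Schwarz. It carries integral
    identities from L^1 /\ L^2 to L^2. *)
Lemma cvg_Rintegral_sqint (u : nat -> T -> R) f w : (forall n, sqint (u n)) ->
  sqint f -> sqint w -> \int[mu]_x (u n x - f x) ^+ 2 @[n --> \oo] --> 0 ->
  \int[mu]_x (u n x * w x) @[n --> \oo] --> \int[mu]_x (f x * w x).
Proof.
move=> u2 f2 w2 uf; set W := \int[mu]_x w x ^+ 2.
have W0 : 0 <= W := Rintegral_sqr_ge0 w.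
apply/subr_cvg0.
have -> : (fun n => \int[mu]_x (u n x * w x) - \int[mu]_x (f x * w x)) =
    (fun n => \int[mu]_x ((u n x - f x) * w x)).
  apply/funext => n; rewrite -RintegralB//; [|exact: sqintM..].
  by apply: eq_Rintegral => x _; ring.
have sq0 : Num.sqrt (\int[mu]_x (u n x - f x) ^+ 2 * W) @[n --> \oo] --> 0.
  rewrite -[X in _ --> X](@sqrtr0 R) -(mul0r W).
  apply: continuous_cvg; first exact: sqrt_continuous.
  by apply: cvgM => //; exact: cvg_cst.
apply/cvgr0Pnorm_le => e e0.
move/cvgr0Pnorm_le : sq0 => /(_ e e0); apply: filterS => n; apply: le_trans.
rewrite (ger0_norm (sqrtr_ge0 _)) -sqrtr_sqr ler_wsqrtr//.
by apply: Rintegral_CauchySchwarz => //; exact: sqintB.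
Qed.

End square_integrable.

(** * Fubini's theorem for real-valued integrals *)

Section fubini.
Context (R : realType).
Local Notation mu := (@lebesgue_measure R).
Local Notation L1 f := (mu.-integrable [set: R] (EFin \o f)).
Local Notation RR := (measurableTypeR R * measurableTypeR R)%type.

(** All sections, not just almost all, are assumed integrable, so that each inner real integral
    coincides with the extended one at every point. *)
Lemma Rintegral_fubini (F : RR -> R) :
  (mu \x mu)%E.-integrable setT (EFin \o F) ->
  (forall x, L1 (fun y => F (x, y))) -> (forall y, L1 (fun x => F (x, y))) ->
  L1 (fun x => \int[mu]_y F (x, y)) /\
  \int[mu]_x \int[mu]_y F (x, y) = \int[mu]_y \int[mu]_x F (x, y).
Proof.
move=> F1 Fx Fy.
have E1 x : (\int[mu]_y F (x, y))%:E = (\int[mu]_y (F (x, y))%:E)%E.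
  exact: EFin_RintegralT.
have E2 y : (\int[mu]_x F (x, y))%:E = (\int[mu]_x (F (x, y))%:E)%E.
  exact: (EFin_RintegralT (Fy y)).
split.
- have := integrable_fubini_F F1; apply: eq_integrable => // x _ /=.
  by rewrite E1.
- rewrite /Rintegral; congr fine; have := Fubini F1 => /= FF.
  by under eq_integral do rewrite E1; under [RHS]eq_integral do rewrite E2.
Qed.

(** By Tonelli the tensor product of [a] and [b] is integrable, with norm the product of the two
    norms; a bounded factor preserves this. *)
Lemma integrable_prodM (a b : R -> R) (m : RR -> R) C : L1 a -> L1 b ->
  measurable_fun setT m -> (forall z, `|m z| <= C) ->
  (mu \x mu)%E.-integrable setT (EFin \o (fun z : RR => a z.1 * b z.2 * m z)).
Proof.
move=> a1 b1 mm mC; apply: (@integrableMbT _ RR R (mu \x mu)%E (fun z : RR => a z.1 * b z.2) m C) => //.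
have ma := integrable_measurableT a1; have mb := integrable_measurableT b1.
apply/integrable12ltyP.
  apply/measurable_EFinP; apply: measurable_funM; apply: measurableT_comp => //.
under eq_integral => x _.
  under eq_integral do rewrite /= normrM EFinM.
  rewrite ge0_integralZl//; last by apply/measurable_EFinP; exact: measurableT_comp.
  over.
have b0 : (0 <= \int[mu]_y `|b y|%:E)%E by apply: integral_ge0 => y _; rewrite lee_fin.
rewrite ge0_integralZr//; last by apply/measurable_EFinP; exact: measurableT_comp.
rewrite lte_mul_pinfty//.
- by apply: integral_ge0 => y _; rewrite lee_fin.
- exact: integrable_fin_num (integrable_norm a1).
- by have /integrableP[_] := b1.
Qed.

End fubini.

(** * The Hartley transform and the Poisson kernel *)

Section hartley.
Context (R : realType).
Local Notation mu := (@lebesgue_measure R).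
Local Notation L1 f := (mu.-integrable [set: R] (EFin \o f)).
Local Notation RR := (measurableTypeR R * measurableTypeR R)%type.
Implicit Types (u v f g : R -> R) (x y : R).

Definition hkernel x y : R := cos (2 * pi * x * y) + sin (2 * pi * x * y).

Definition hartley u y : R := \int[mu]_x (u x * hkernel x y).

Lemma hkernel_le2 x y : `|hkernel x y| <= 2.
Proof.
rewrite /hkernel (le_trans (ler_normD _ _))//.
rewrite -[X in _ <= X]/(1 + 1); apply: lerD; rewrite ler_norml.
  by rewrite cos_geN1 cos_le1.
by rewrite sin_geN1 sin_le1.
Qed.

Lemma hkernelC x y : hkernel x y = hkernel y x.
Proof. by rewrite /hkernel -mulrA (mulrC x) mulrA. Qed.

Lemma measurable_hkernel2 : measurable_fun setT (fun z : RR => hkernel z.1 z.2).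
Proof.
have m0 : measurable_fun setT (fun z : RR => 2 * pi * z.1 * z.2 : R).
  by apply: measurable_funM => //; exact: measurable_funM.
apply: measurable_funD; apply: measurableT_comp => //; apply: continuous_measurable_fun.
  exact: continuous_cos.
exact: continuous_sin.
Qed.

Lemma continuous_hkernel x : continuous (hkernel x).
Proof.
have c0 : continuous (fun y => 2 * pi * x * y) by exact: mulrl_continuous.
move=> y; apply: cvgD; apply: continuous_comp; try exact: c0.
  exact: continuous_cos.
exact: continuous_sin.
Qed.

Lemma measurable_hkernel x : measurable_fun setT (hkernel x).
Proof. by apply: continuous_measurable_fun; exact: continuous_hkernel. Qed.

Lemma measurable_hkernelr y : measurable_fun setT (hkernel^~ y).
Proof.
by under eq_fun do rewrite hkernelC; exact: measurable_hkernel.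
Qed.

Lemma integrable_hkernel u y : L1 u -> L1 (fun x => u x * hkernel x y).
Proof.
move=> u1; apply: (integrableMbT u1 (measurable_hkernelr y)) => x.
exact: hkernel_le2.
Qed.

Lemma hartley_le u y : L1 u -> `|hartley u y| <= 2 * \int[mu]_x `|u x|.
Proof.
move=> u1; have n1 : L1 (fun x => `|u x|) := integrable_norm u1.
have k1 := integrable_hkernel y u1.
rewrite (le_trans (le_normr_Rintegral _ k1))//.
rewrite -RintegralZl//; apply: le_Rintegral => //.
- exact: integrable_norm.
- exact: integrableZT.
by move=> x _; rewrite normrM mulrC ler_wpM2r// hkernel_le2.
Qed.

Lemma continuous_hartley u : L1 u -> continuous (hartley u).
Proof.
move=> u1 y.
apply: (@continuity_under_integral _ _ _ mu (fun y x => u x * hkernel x y) setT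
  measurableT (y - 1) (y + 1) _ _ (fun x => 2 * `|u x|)).
- by move=> z _; exact: integrable_hkernel.
- apply: aeW => x _ z _; apply: cvgM; first exact: cvg_cst.
  exact: continuous_hkernel.
- by apply: integrableZT; exact: integrable_norm.
- by move=> z _; apply: aeW => x _; rewrite normrM mulrC ler_wpM2r// hkernel_le2.
- by rewrite inE /= in_itv /= ltrBlDr ltrDl ltr01.
Qed.

Lemma measurable_hartley u : L1 u -> measurable_fun setT (hartley u).
Proof. by move=> u1; apply: continuous_measurable_fun; exact: continuous_hartley. Qed.

Lemma integrable_hartleyM u v : L1 u -> L1 v -> L1 (fun y => v y * hartley u y).
Proof.
by move=> u1 v1; apply: (integrableMbT v1 (measurable_hartley u1)) => x; exact: hartley_le.
Qed.

(** The multiplication formula: Fubini, together with the symmetry of the kernel. *)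
Lemma hartley_mul u v : L1 u -> L1 v ->
  \int[mu]_y (hartley u y * v y) = \int[mu]_x (u x * hartley v x).
Proof.
move=> u1 v1.
have i2 := integrable_prodM u1 v1 measurable_hkernel2 (fun z => hkernel_le2 z.1 z.2).
have [||_ /= FF] := Rintegral_fubini i2.
- move=> x; have := integrableZT (u x) (integrable_hkernel x v1).
  by apply: eq_integrable => // y _ /=; rewrite (hkernelC x) mulrA.
- move=> y; have := integrableZT (v y) (integrable_hkernel y u1).
  by apply: eq_integrable => // x _ /=; rewrite mulrCA mulrA.
transitivity (\int[mu]_y \int[mu]_x (u x * v y * hkernel x y)).
  apply: eq_Rintegral => y _; rewrite mulrC -RintegralZl//; last exact: integrable_hkernel.
  by apply: eq_Rintegral => x _; ring.
rewrite -FF.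
apply: eq_Rintegral => x _; rewrite -RintegralZl//; last exact: integrable_hkernel.
by apply: eq_Rintegral => y _; rewrite (hkernelC x); ring.
Qed.

End hartley.

(** * Invariance of the Lebesgue integral under reflection *)

Section reflection.
Context (R : realType).
Local Notation mu := (@lebesgue_measure R).
Local Notation L1 f := (mu.-integrable [set: R] (EFin \o f)).

Lemma ge0_integral_oppT (f : R -> \bar R) : measurable_fun setT f ->
  (forall x, (0 <= f x)%E) -> (\int[mu]_x f (- x)%R = \int[mu]_x f x)%E.
Proof.
move=> mf f0.
have mo : measurable_fun [set: measurableTypeR R] (-%R : R -> measurableTypeR R).
  exact: oppr_measurable.
have := @ge0_integral_pushforward _ _ _ _ R _ mo mu setT f measurableT mf (fun x _ => f0 x).
rewrite preimage_setT => <-; apply: eq_measure_integral => A mA _.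
exact: lebesgue_measureN.
Qed.

Lemma measurable_fun_opp (f : R -> R) : measurable_fun setT f ->
  measurable_fun setT (fun x : R => f (- x)).
Proof. by move=> mf; apply: (measurableT_comp mf); exact: oppr_measurable. Qed.

Lemma integrable_opp (f : R -> R) : L1 f -> L1 (fun x : R => f (- x)).
Proof.
move=> f1; have mf := integrable_measurableT f1.
apply/integrableP; split; first by apply/measurable_EFinP; exact: measurable_fun_opp.
rewrite (@ge0_integral_oppT (fun x => `|(f x)%:E|%E)) //; first by have /integrableP[] := f1.
by apply/measurable_EFinP; exact: measurableT_comp.
Qed.

Lemma Rintegral_opp (f : R -> R) : L1 f -> \int[mu]_x f (- x) = \int[mu]_x f x.
Proof.
move=> f1; have mf := integrable_measurableT f1.
have mfE : measurable_fun setT (EFin \o f) by exact/measurable_EFinP.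
rewrite /Rintegral; congr fine; rewrite integralE [RHS]integralE.
congr (_ - _)%E.
- rewrite -(@ge0_integral_oppT (EFin \o f)^\+%E) //; last exact: measurable_funepos.
  by apply: eq_integral => x _; rewrite !funeposE.
- rewrite -(@ge0_integral_oppT (EFin \o f)^\-%E) //; last exact: measurable_funeneg.
  by apply: eq_integral => x _; rewrite !funenegE.
Qed.

Lemma sqint_opp (f : R -> R) : sqint mu f -> sqint mu (fun x : R => f (- x)).
Proof.
move=> [mf f2]; split; first exact: measurable_fun_opp.
exact: (@integrable_opp (fun x => f x ^+ 2)).
Qed.

End reflection.

(** * The transform of a two-sided exponential and the Poisson kernel *)

Section poisson.
Context (R : realType).
Local Notation mu := (@lebesgue_measure R).
Local Notation L1 f := (mu.-integrable [set: R] (EFin \o f)).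
Local Notation W b := (fun x : R => expR (- (b * `|x|))).

Section exp_cos.
Variables (b c : R).
Hypothesis b0 : 0 < b.

Let den0 : b ^+ 2 + c ^+ 2 != 0.
Proof. by rewrite gt_eqF// ltr_pwDl ?exprn_gt0// sqr_ge0. Qed.

(** An antiderivative of [expR (- (b * x)) * (1 + cos (c * x))], normalised to vanish at +oo;
    [- F 0] is its integral over the half-line. *)
Let F (x : R) := - (expR (- (b * x)) *
  (b^-1 + (b * cos (c * x) - c * sin (c * x)) / (b ^+ 2 + c ^+ 2))).

Let dF (x : R) : is_derive x 1 F (expR (- (b * x)) * (1 + cos (c * x))).
Proof.
have d1 : is_derive x 1 (fun x => expR (- (b * x))) (- b * expR (- (b * x))).
  have d0 : is_derive x 1 (fun x => - (b * x)) (- b).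
    by apply: is_derive_eq; rewrite /GRing.scale /= ; ring.
  have := @is_derive1_comp R expR (fun x => - (b * x)) x _ _ (is_derive_expR _) d0.
  by move=> H; apply: is_derive_eq; rewrite mulrC.
have dc : is_derive x 1 (fun x => c * x) c.
  by apply: is_derive_eq; rewrite /GRing.scale /= ; ring.
have d2 : is_derive x 1 (fun x => cos (c * x)) (- c * sin (c * x)).
  have := @is_derive1_comp R cos (fun x => c * x) x _ _ (is_derive_cos _) dc.
  by move=> H; apply: is_derive_eq; ring.
have d3 : is_derive x 1 (fun x => sin (c * x)) (c * cos (c * x)).
  have := @is_derive1_comp R sin (fun x => c * x) x _ _ (is_derive_sin _) dc.
  by move=> H; apply: is_derive_eq; ring.
rewrite /F; apply: is_derive_eq.
rewrite /GRing.scale /=; field.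
by rewrite den0 gt_eqF.
Qed.

Lemma continuous_exp_abs : continuous (W b).
Proof.
move=> x; apply: continuous_comp; last exact: continuous_expR.
by apply: continuousN; apply: continuousM; [exact: cst_continuous|exact: norm_continuous].
Qed.

Let continuous_f : continuous (fun x => W b x * (1 + cos (c * x))).
Proof.
move=> x; apply: continuousM; first exact: continuous_exp_abs.
apply: continuousD; first exact: cst_continuous.
by apply: continuous_comp; [exact: mulrl_continuous|exact: continuous_cos].
Qed.

Let continuous_g : continuous (fun x : R => expR (- (b * x)) * (1 + cos (c * x))).
Proof.
move=> x; apply: cvgM.
  apply: continuous_comp; last exact: continuous_expR.
  by apply: continuousN; exact: mulrl_continuous.
apply: cvgD; first exact: cvg_cst.
by apply: continuous_comp; [exact: mulrl_continuous|exact: continuous_cos].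
Qed.

Let F0 : F x @[x --> +oo] --> (0 : R).
Proof.
pose C := b^-1 + (b + `|c|) / (b ^+ 2 + c ^+ 2).
have e0 : (expR (- (b * x)) * C) @[x --> +oo] --> (0 : R).
  rewrite -(mul0r C); apply: cvgM; last exact: cvg_cst.
  apply: (@cvg_comp _ _ _ (fun x => b * x) (fun z => expR (- z)) _ (pinfty_nbhs R)); last exact: cvgr_expR.
  exact: gt0_cvgMry.
apply/cvgr0Pnorm_le => e e1; move/cvgr0Pnorm_le : e0 => /(_ e e1).
apply: filterS => x; apply: le_trans.
rewrite normrN !normrM ler_wpM2l//.
have d0 : 0 < b ^+ 2 + c ^+ 2 by rewrite ltr_pwDl ?exprn_gt0// sqr_ge0.
have C0 : 0 <= C by rewrite addr_ge0 ?invr_ge0 ?(ltW b0)// divr_ge0 ?(ltW d0)// addr_ge0// ltW.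
rewrite (ger0_norm C0) (le_trans (ler_normD _ _))// lerD//.
  by rewrite ger0_norm// invr_ge0 ltW.
have i0 : 0 <= (b ^+ 2 + c ^+ 2)^-1 by rewrite invr_ge0 ltW.
rewrite normrM (ger0_norm i0) ler_wpM2r// (le_trans (ler_normB _ _))// lerD// normrM.
  rewrite gtr0_norm//; apply: ler_piMr; first exact: ltW.
  by rewrite ler_norml cos_geN1 cos_le1.
by apply: ler_piMr => //; rewrite ler_norml sin_geN1 sin_le1.
Qed.

(** Adding 1 to the cosine makes the integrand nonnegative, so the fundamental theorem on a
    half-line applies before integrability is known; evenness gives the factor 2. *)
Lemma integral_exp_1Dcos :
  (\int[mu]_x (W b x * (1 + cos (c * x)))%:E =
   (2 * (b^-1 + b / (b ^+ 2 + c ^+ 2)))%:E)%E.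
Proof.
have cos1 (t : R) : 0 <= 1 + cos t by rewrite -lerBlDl sub0r cos_geN1.
rewrite ge0_symfun_integralT//; last first.
  by move=> x /=; rewrite normrN mulrN cosN.
rewrite EFinM; congr (_ * _)%E.
rewrite (_ : [set x | 0 <= x] = `[0, +oo[%classic); last by rewrite set_itvE.
transitivity (\int[mu]_(x in `[0%R, +oo[) (expR (- (b * x)) * (1 + cos (c * x)))%:E)%E.
  by apply: eq_integral => x; rewrite inE /= in_itv /= andbT => x0; rewrite ger0_norm.
rewrite (@ge0_continuous_FTC2y _ _ F 0 0).
- by rewrite /F !mulr0 oppr0 expR0 cos0 sin0 !mulr0 subr0 mulr1 mul1r -EFinB; congr EFin; rewrite sub0r opprK.
- by move=> x _; rewrite mulr_ge0 ?expR_ge0.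
- by apply: continuous_subspaceT; exact: continuous_g.
- exact: F0.
- by move=> x _; have [] := dF x.
- apply: cvg_at_right_filter; apply: differentiable_continuous; apply/derivable1_diffP.
  by have [] := dF 0.
- by move=> x _; rewrite derive1E; have [_ ->] := dF x.
Qed.

End exp_cos.
(** The case [c = 0] of the previous integral, whose integrand is twice the weight. *)
Lemma integrable_exp_abs b : 0 < b -> L1 (W b).
Proof.
move=> b0; have := integral_exp_1Dcos 0 b0.
set l := (X in X%:E) => El.
have mf : measurable_fun setT (fun x : R => W b x * (1 + cos (0 * x))).
  apply: measurable_funM; first by apply: continuous_measurable_fun; exact: continuous_exp_abs.
  by under eq_fun do rewrite mul0r; exact: measurable_cst.
have f0 (x : R) : 0 <= W b x * (1 + cos (0 * x)).
  by rewrite mul0r cos0 mulr_ge0 ?expR_ge0.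
have [|f1 _] := @ge0_bounded_integrable _ _ _ mu _ l mf f0; first by rewrite El.
have := integrableZT 2^-1 f1.
by apply: eq_integrable => // x _ /=; rewrite mul0r cos0; congr EFin; field.
Qed.

Lemma measurable_cosM (c : R) : measurable_fun setT (fun x : R => cos (c * x)).
Proof.
apply: continuous_measurable_fun => x.
by apply: continuous_comp; [exact: mulrl_continuous|exact: continuous_cos].
Qed.

Lemma measurable_sinM (c : R) : measurable_fun setT (fun x : R => sin (c * x)).
Proof.
apply: continuous_measurable_fun => x.
by apply: continuous_comp; [exact: mulrl_continuous|exact: continuous_sin].
Qed.

Lemma cos_le1n (t : R) : `|cos t| <= 1. Proof. by rewrite ler_norml cos_geN1 cos_le1. Qed.

Lemma sin_le1n (t : R) : `|sin t| <= 1. Proof. by rewrite ler_norml sin_geN1 sin_le1. Qed.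

Lemma integrable_exp_cos b c : 0 < b -> L1 (fun x => W b x * cos (c * x)).
Proof.
move=> b0; apply: (integrableMbT (integrable_exp_abs b0) (measurable_cosM c)) => x.
exact: cos_le1n.
Qed.

Lemma integrable_exp_sin b c : 0 < b -> L1 (fun x => W b x * sin (c * x)).
Proof.
move=> b0; apply: (integrableMbT (integrable_exp_abs b0) (measurable_sinM c)) => x.
exact: sin_le1n.
Qed.

(** The added 1 is subtracted again; its contribution [2 / b] is read off at [c = 0]. *)
Lemma Rintegral_exp_cos b c : 0 < b ->
  \int[mu]_x (W b x * cos (c * x)) = 2 * b / (b ^+ 2 + c ^+ 2).
Proof.
move=> b0.
have E1 c' : \int[mu]_x (W b x * (1 + cos (c' * x))) =
   2 * (b^-1 + b / (b ^+ 2 + c' ^+ 2)).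
  by rewrite /Rintegral integral_exp_1Dcos.
have ED c' : \int[mu]_x (W b x * (1 + cos (c' * x))) =
   \int[mu]_x (W b x) + \int[mu]_x (W b x * cos (c' * x)).
  rewrite -RintegralD//; [|exact: integrable_exp_abs|exact: integrable_exp_cos].
  by apply: eq_Rintegral => x _; rewrite mulrDr mulr1.
have E0 : \int[mu]_x (W b x * cos (0 * x)) = \int[mu]_x (W b x).
  by apply: eq_Rintegral => x _; rewrite mul0r cos0 mulr1.
have EW : \int[mu]_x (W b x) = 2 / b.
  have := E1 0; rewrite ED E0 => H.
  apply: (@mulfI _ 2) => //; rewrite mulr_natl mulr2n H; field; by rewrite gt_eqF.
have := E1 c; rewrite ED EW => H.
by apply: (addrI (2 / b)); rewrite H; ring.
Qed.

(** The integrand is odd, so the integral is its own opposite. *)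
Lemma Rintegral_exp_sin b c : 0 < b -> \int[mu]_x (W b x * sin (c * x)) = 0.
Proof.
move=> b0; have i1 := integrable_exp_sin c b0.
have := Rintegral_opp i1.
under eq_Rintegral do rewrite normrN mulrN sinN mulrN -mulN1r.
by rewrite RintegralZl//; lra.
Qed.

(** The Poisson kernel of the upper half-plane at height [a], that is, the Cauchy density centred at
    [x] with scale [a]. *)
Definition poisson (a x y : R) : R := a / (pi * (a ^+ 2 + (x - y) ^+ 2)).

(** The product of two Hartley kernels is the cosine of the difference of the angles plus the sine
    of their sum. The sine part integrates to 0 by parity. *)
Lemma hartley_exp_abs (a x y : R) : 0 < a ->
  hartley (fun z => W (2 * pi * a) z * hkernel x z) y = poisson a x y.
Proof.
move=> a0; have p0 : 0 < pi :> R := pi_gt0 R.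
have b0 : 0 < 2 * pi * a by rewrite !mulr_gt0.
rewrite /hartley.
transitivity (\int[mu]_z (W (2 * pi * a) z * cos (2 * pi * (x - y) * z) +
                          W (2 * pi * a) z * sin (2 * pi * (x + y) * z))).
  apply: eq_Rintegral => z _; rewrite (hkernelC z) /hkernel.
  rewrite (_ : 2 * pi * (x - y) * z = 2 * pi * x * z - 2 * pi * y * z); last by ring.
  rewrite (_ : 2 * pi * (x + y) * z = 2 * pi * x * z + 2 * pi * y * z); last by ring.
  by rewrite cosB sinD; ring.
rewrite RintegralD//; [|exact: integrable_exp_cos|exact: integrable_exp_sin].
rewrite Rintegral_exp_cos// Rintegral_exp_sin// addr0 /poisson.
have d1 : a ^+ 2 + (x - y) ^+ 2 != 0 by rewrite gt_eqF// ltr_pwDl ?exprn_gt0// sqr_ge0.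
have -> : (2 * pi * a) ^+ 2 + (2 * pi * (x - y)) ^+ 2 =
  4 * pi ^+ 2 * (a ^+ 2 + (x - y) ^+ 2) by ring.
clear b0; move: p0; move: (@pi R) => p p0.
by field; rewrite d1 gt_eqF.
Qed.

Lemma poissonC a x y : poisson a x y = poisson a y x.
Proof. by rewrite /poisson -(sqrrN (x - y)) opprB. Qed.

Lemma poisson_ge0 a x y : 0 < a -> 0 <= poisson a x y.
Proof.
by move=> a0; rewrite divr_ge0 ?(ltW a0)// mulr_ge0 ?pi_ge0// addr_ge0 ?sqr_ge0.
Qed.

Lemma poisson_le a x y : 0 < a -> `|poisson a x y| <= (pi * a)^-1.
Proof.
move=> a0; have p0 : 0 < pi :> R := pi_gt0 R.
rewrite ger0_norm ?poisson_ge0// /poisson.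
have d1 : 0 < a ^+ 2 + (x - y) ^+ 2 by rewrite ltr_pwDl ?exprn_gt0// sqr_ge0.
rewrite ler_pdivrMr ?mulr_gt0//.
have -> : (pi * a)^-1 * (pi * (a ^+ 2 + (x - y) ^+ 2)) = a + (x - y) ^+ 2 / a.
  by move: p0; move: (@pi R) => p p0; field; rewrite !gt_eqF.
by rewrite lerDl divr_ge0 ?sqr_ge0// ltW.
Qed.

Lemma poissonE a x y : 0 < a ->
  poisson a x y = pi^-1 * (oneDsqr ((y - x) / a))^-1 * a^-1.
Proof.
move=> a0; have p0 : 0 < pi :> R := pi_gt0 R.
have d1 : 0 < a ^+ 2 + (x - y) ^+ 2 by rewrite ltr_pwDl ?exprn_gt0// sqr_ge0.
have d2 : 0 < a ^+ 2 + (y - x) ^+ 2 by rewrite ltr_pwDl ?exprn_gt0// sqr_ge0.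
rewrite /poisson /oneDsqr -(sqrrN (x - y)) opprB; move: p0; move: (@pi R) => p p0.
by field; rewrite !gt_eqF.
Qed.

Lemma integral_oneDsqrV : (\int[mu]_x (pi^-1 * (oneDsqr x)^-1)%:E = 1)%E.
Proof.
have p0 : 0 < pi :> R := pi_gt0 R.
rewrite ge0_symfun_integralT.
- rewrite (_ : [set x : R | 0 <= x] = `[0, +oo[%classic); last by rewrite set_itvE.
  under eq_integral do rewrite EFinM.
  rewrite ge0_integralZl//.
  + rewrite integral0y_oneDsqr -!EFinM; congr EFin.
    by move: p0; move: (@pi R) => p p0; field; rewrite gt_eqF.
  + apply/measurable_EFinP; apply: measurable_funTS; apply: continuous_measurable_fun.
    exact: continuous_oneDsqrV.
  + by rewrite lee_fin invr_ge0 ltW.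
- by move=> x; rewrite mulr_ge0// invr_ge0 ?ltW// addr_ge0 ?sqr_ge0.
- by move=> x; apply: cvgM; [exact: cvg_cst|exact: continuous_oneDsqrV].
- by move=> x /=; rewrite /oneDsqr sqrrN.
Qed.

Let affine_derive a x : ((fun y : R => (y - x) / a)^`())%classic = cst a^-1.
Proof.
apply/funext => y; rewrite derive1E.
have : is_derive y 1 (fun y : R => (y - x) / a) a^-1.
  by apply: is_derive_eq; rewrite /GRing.scale /=; ring.
by case.
Qed.

Lemma continuous_poisson a x : 0 < a -> continuous (poisson a x).
Proof.
move=> a0; have -> : poisson a x = (fun y => pi^-1 * (oneDsqr ((y - x) / a))^-1 * a^-1).
  by apply/funext => y; exact: poissonE.
move=> y; apply: cvgM; last exact: cvg_cst.
apply: cvgM; first exact: cvg_cst.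
apply: (@continuous_comp _ _ _ (fun y => (y - x) / a) (fun t : R => (oneDsqr t)^-1)); last exact: continuous_oneDsqrV.
apply: cvgM; last exact: cvg_cst.
by apply: cvgB => //; exact: cvg_cst.
Qed.

(** The substitution [(y - x) / a] reduces this to the derivative of the arctangent. *)
Lemma integral_poisson a x : 0 < a -> (\int[mu]_y (poisson a x y)%:E = 1)%E.
Proof.
move=> a0; have p0 : 0 < pi :> R := pi_gt0 R.
rewrite -integral_oneDsqrV.
rewrite [RHS](@increasing_ge0_integration_by_substitutionT _ (fun y => (y - x) / a)) //.
- by apply: eq_integral => y _; rewrite affine_derive /= poissonE.
- by move=> u v uv; rewrite ltr_pM2r ?invr_gt0// ltrD2r.
- by rewrite affine_derive => u; exact: cvg_cst.
- by rewrite affine_derive; apply/cvg_ex; exists a^-1; exact: cvg_cst.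
- by rewrite affine_derive; apply/cvg_ex; exists a^-1; exact: cvg_cst.
- apply/cvgrNyPle => M; near=> y; rewrite ler_pdivrMr// lerBlDr.
  by near: y; apply: nbhs_ninfty_le; exact: num_real.
- apply/cvgryPge => M; near=> y; rewrite ler_pdivlMr// lerBrDr.
  by near: y; apply: nbhs_pinfty_ge; exact: num_real.
- by move=> y; apply: cvgM; [exact: cvg_cst|exact: continuous_oneDsqrV].
- by move=> y; rewrite mulr_ge0// invr_ge0 ?ltW// addr_ge0 ?sqr_ge0.
Unshelve. all: by end_near. Qed.

Lemma integrable_poisson a x : 0 < a -> L1 (poisson a x).
Proof.
move=> a0; have mp : measurable_fun setT (poisson a x).
  by apply: continuous_measurable_fun; exact: continuous_poisson.
have [|//] := @ge0_bounded_integrable _ _ _ mu _ 1 mp (fun y => poisson_ge0 x y a0).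
by rewrite integral_poisson.
Qed.

Lemma Rintegral_poisson a x : 0 < a -> \int[mu]_y poisson a x y = 1.
Proof. by move=> a0; rewrite /Rintegral integral_poisson. Qed.

Lemma Rintegral_poisson_itv (a x c d : R) : 0 < a -> c < d ->
  \int[mu]_(y in `[c, d]) poisson a x y =
  pi^-1 * (atan ((d - x) / a) - atan ((c - x) / a)).
Proof.
move=> a0 cd; pose F := fun y : R => pi^-1 * atan ((y - x) / a).
have dF (y : R) : is_derive y 1 F (poisson a x y).
  have d0 : is_derive y 1 (fun y : R => (y - x) / a) a^-1.
    by apply: is_derive_eq; rewrite /GRing.scale /=; ring.
  have := @is_derive1_comp R (@atan R) (fun y => (y - x) / a) y _ _ (is_derive1_atan _) d0.
  move=> H; apply: is_derive_eq; rewrite /GRing.scale /= poissonE// /oneDsqr; ring.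
have cF : continuous F.
  move=> y; apply: differentiable_continuous; apply/derivable1_diffP.
  by have [] := dF y.
rewrite /Rintegral (@continuous_FTC2 _ _ F) //.
- by rewrite /= /F mulrBr.
- by apply: continuous_subspaceT; exact: continuous_poisson.
- split.
  + by move=> y _; have [] := dF y.
  + by apply: cvg_at_right_filter; exact: cF.
  + by apply: cvg_at_left_filter; exact: cF.
- by move=> y _; rewrite derive1E; have [_ ->] := dF y.
Qed.

Lemma measurable_poisson2 a : 0 < a ->
  measurable_fun setT (fun z : measurableTypeR R * measurableTypeR R => poisson a z.1 z.2).
Proof.
move=> a0.
have m0 : measurable_fun setT (fun z : measurableTypeR R * measurableTypeR R => (z.2 - z.1) / a : R).
  by apply: measurable_funM => //; exact: measurable_funB.
under eq_fun do rewrite poissonE//.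
apply: measurable_funM => //; apply: measurable_funM => //.
have mo : measurable_fun setT (fun t : R => (oneDsqr t)^-1).
  by apply: continuous_measurable_fun; exact: continuous_oneDsqrV.
exact: (measurableT_comp mo m0).
Qed.

End poisson.

(** * Plancherel inequalities *)

Section contraction.
Context (R : realType).
Local Notation mu := (@lebesgue_measure R).
Local Notation L1 f := (mu.-integrable [set: R] (EFin \o f)).
Local Notation RR := (measurableTypeR R * measurableTypeR R)%type.
Local Notation W a := (fun x : R => expR (- (2 * pi * a * `|x|))).
Implicit Types (u v f g : R -> R) (a x y : R).

Lemma integrable_poisson_kernel a : 0 < a -> L1 (W a).
Proof. by move=> a0; apply: integrable_exp_abs; rewrite !mulr_gt0 ?pi_gt0. Qed.

Lemma poisson_kernel_le1 a x : 0 < a -> W a x <= 1.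
Proof.
move=> a0; rewrite -expR0 ler_expR oppr_le0 mulr_ge0// ltW// !mulr_gt0//.
exact: pi_gt0.
Qed.

Lemma cvg_poisson_kernel x : W (harmonic n) x @[n --> \oo] --> (1 : R).
Proof.
rewrite /= -[X in _ --> X]expR0; apply: continuous_cvg; first exact: continuous_expR.
rewrite -oppr0; apply: cvgN.
rewrite -[X in _ --> X](mul0r `|x|); apply: cvgM; last exact: cvg_cst.
rewrite -[X in _ --> X](mulr0 (2 * pi)); apply: cvgM; first exact: cvg_cst.
exact: cvg_harmonic.
Qed.

(** Damping the transform by [W a] and transforming back smooths [v] by the Poisson kernel:
    [hartley_mul] moves the transform onto the weighted kernel. *)
Lemma hartley_poisson v a y : L1 v -> 0 < a ->
  hartley (fun z => W a z * hartley v z) y = \int[mu]_x (v x * poisson a x y).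
Proof.
move=> v1 a0; have W1 := integrable_poisson_kernel a0.
have Wk1 : L1 (fun z => W a z * hkernel y z).
  by have := integrable_hkernel y W1; under eq_fun do rewrite hkernelC.
transitivity (\int[mu]_z (hartley v z * (W a z * hkernel y z))).
  by apply: eq_Rintegral => z _; rewrite (hkernelC z); ring.
rewrite hartley_mul//; apply: eq_Rintegral => x _.
by rewrite hartley_exp_abs// poissonC.
Qed.

Lemma integrableM_poisson v a y : L1 v -> 0 < a -> L1 (fun x => v x * poisson a x y).
Proof.
move=> v1 a0; under eq_fun do rewrite poissonC.
apply: (integrableMbT v1 _ (fun x => poisson_le y x a0)).
exact: continuous_measurable_fun (continuous_poisson a0).
Qed.

(** Tonelli, integrating first in the variable in which the kernel has total mass 1. *)
Lemma Rintegral_sqr_poisson v a : sqint mu v -> 0 < a ->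
  L1 (fun x => \int[mu]_z (v z ^+ 2 * poisson a z x)) /\
  \int[mu]_x \int[mu]_z (v z ^+ 2 * poisson a z x) = \int[mu]_z v z ^+ 2.
Proof.
move=> [mv v2] a0; pose F (p : RR) := v p.2 ^+ 2 * poisson a p.2 p.1.
have mF : measurable_fun setT F.
  apply: measurable_funM; first by apply: measurable_funX; exact: measurableT_comp.
  under eq_fun do rewrite poissonC.
  exact: measurable_poisson2.
have F1 : (mu \x mu)%E.-integrable setT (EFin \o F).
  apply/integrable21ltyP; first exact/measurable_EFinP.
  have inner y : (\int[mu]_x `|(EFin \o F) (x, y)| = (v y ^+ 2)%:E)%E.
    have FE x : (`|(EFin \o F) (x, y)| = (v y ^+ 2)%:E * (poisson a y x)%:E)%E.
      by rewrite /F /= ger0_norm// mulr_ge0 ?sqr_ge0 ?poisson_ge0.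
    under eq_integral do rewrite FE.
    rewrite ge0_integralZl ?integral_poisson ?mule1//.
    - by apply/measurable_EFinP; exact: continuous_measurable_fun (continuous_poisson a0).
    - by move=> x _; rewrite lee_fin poisson_ge0.
    - by rewrite lee_fin sqr_ge0.
  under eq_integral do rewrite inner.
  exact: integrable_lty v2.
have Fx x : L1 (fun z => F (x, z)) by exact: integrableM_poisson.
have Fz z : L1 (fun x => F (x, z)).
  by rewrite /F /=; apply: integrableZT; exact: integrable_poisson.
have [i1 ->] := Rintegral_fubini F1 Fx Fz; split=> //.
apply: eq_Rintegral => z _; rewrite /F /= RintegralZl//; last exact: integrable_poisson.
by rewrite Rintegral_poisson// mulr1.
Qed.

(** The left side is the double integral of [v x * v z * poisson a z x]. Bounding [v x * v z] by
    half the sum of the squares and using that both marginals of the kernel are 1 gives the claim,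
    as in Schur's test. *)
Lemma Rintegral_hartley_sqr_reg v a : L1 v -> sqint mu v -> 0 < a ->
  \int[mu]_z (W a z * hartley v z ^+ 2) <= \int[mu]_x v x ^+ 2.
Proof.
move=> v1 v2 a0; have W1 := integrable_poisson_kernel a0.
have [i2 e2] := Rintegral_sqr_poisson v2 a0.
have WH1 : L1 (fun z => W a z * hartley v z) := integrable_hartleyM v1 W1.
have -> : \int[mu]_z (W a z * hartley v z ^+ 2) =
    \int[mu]_x (v x * \int[mu]_z (v z * poisson a z x)).
  transitivity (\int[mu]_z (hartley v z * (W a z * hartley v z))).
    by apply: eq_Rintegral => z _; ring.
  by rewrite hartley_mul//; apply: eq_Rintegral => x _; congr (_ * _); exact: hartley_poisson.
have v2' : L1 (fun x => v x ^+ 2) by case: v2.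
have pv x : L1 (fun z => v z ^+ 2 * poisson a z x) by exact: integrableM_poisson.
have -> : \int[mu]_x v x ^+ 2 = \int[mu]_x (2^-1 * v x ^+ 2 +
    2^-1 * \int[mu]_z (v z ^+ 2 * poisson a z x)).
  by rewrite RintegralD ?RintegralZl ?e2//; [field|exact: integrableZT..].
apply: le_Rintegral => //.
- have := integrable_hartleyM WH1 v1; apply: eq_integrable => // x _ /=.
  by rewrite hartley_poisson.
- by apply: integrableDT; exact: integrableZT.
move=> x _.
have p1 := integrable_poisson x a0.
rewrite -RintegralZl//; last exact: integrableM_poisson.
have -> : 2^-1 * v x ^+ 2 + 2^-1 * \int[mu]_z (v z ^+ 2 * poisson a z x) =
    \int[mu]_z (2^-1 * (v x ^+ 2 * poisson a x z) +
                 2^-1 * (v z ^+ 2 * poisson a z x)).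
  rewrite RintegralD//; [|by do 2!apply: integrableZT|exact: integrableZT].
  rewrite RintegralZl//; last exact: integrableZT.
  rewrite (@RintegralZl _ _ _ mu setT (poisson a x) _ measurableT p1).
  by rewrite Rintegral_poisson// mulr1 RintegralZl.
apply: le_Rintegral => //.
- by apply: integrableZT; exact: integrableM_poisson.
- by apply: integrableDT; [do 2!apply: integrableZT|exact: integrableZT].
move=> z _; rewrite (poissonC _ x); have := poisson_ge0 z x a0.
by have := sqr_ge0 (v x - v z); nra.
Qed.

Lemma hartley_contraction v : L1 v -> sqint mu v ->
  sqint mu (hartley v) /\ \int[mu]_z hartley v z ^+ 2 <= \int[mu]_x v x ^+ 2.
Proof.
move=> v1 v2; have mH := measurable_hartley v1.
have h0 n : 0 < harmonic n :> R by rewrite invr_gt0.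
have W1 n := integrable_poisson_kernel (h0 n).
have [||||||i1 le1] := @Rintegral_fatou _ _ _ mu
  (fun n z => W (harmonic n) z * hartley v z ^+ 2)
  (fun z => hartley v z ^+ 2) (\int[mu]_x v x ^+ 2); last by split.
(* For fixed [n] the integral is finite since [hartley v] is bounded and the weight integrable. *)
- move=> n; apply: (@integrableMbT _ _ _ _ _ _ ((2 * \int[mu]_x `|v x|) ^+ 2) (W1 n)
    (measurable_funX _ mH)) => z.
  have h2 := hartley_le z v1.
  by rewrite normrX lerXn2r ?nnegrE// (le_trans _ h2).
- by move=> n z; rewrite mulr_ge0 ?expR_ge0 ?sqr_ge0.
- exact: measurable_funX.
- by move=> z; exact: sqr_ge0.
- apply: aeW => z; rewrite -[X in _ --> X]mul1r; apply: cvgM; last exact: cvg_cst.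
  exact: cvg_poisson_kernel.
- by move=> n; exact: Rintegral_hartley_sqr_reg.
Qed.

End contraction.

(** * Parseval's identity against indicators of intervals *)

Section intervals.
Context (R : realType).
Local Notation mu := (@lebesgue_measure R).
Local Notation L1 f := (mu.-integrable [set: R] (EFin \o f)).
Local Notation W a := (fun x : R => expR (- (2 * pi * a * `|x|))).
Local Notation I c d := (\1_(`[c, d]%classic) : R -> R).
Implicit Types (u v f g : R -> R) (a c d x y : R).

Lemma integrable_itv c d : L1 (I c d).
Proof. exact: (integrable_indic_itv c d true false). Qed.

Lemma measurable_fun_itv c d : measurable_fun setT (I c d).
Proof. exact: integrable_measurableT (integrable_itv c d). Qed.

Lemma itv_le1 c d x : `|I c d x| <= 1.
Proof. by rewrite indicE; case: (_ \in _); rewrite ?normr1 ?normr0. Qed.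

Lemma sqint_itv c d : sqint mu (I c d).
Proof.
split; first exact: measurable_fun_itv.
have := integrable_itv c d; apply: eq_integrable => // x _ /=.
by rewrite indicE; case: (_ \in _); rewrite ?expr1n ?expr0n.
Qed.

Lemma Rintegral_itvM f c d : \int[mu]_x (f x * I c d x) = \int[mu]_(x in `[c, d]) f x.
Proof.
rewrite [RHS]Rintegral_mkcond; apply: eq_Rintegral => x _.
by rewrite patchE indicE; case: (_ \in _); rewrite ?mulr1 ?mulr0.
Qed.

Lemma Rintegral_itvE c d : c <= d -> \int[mu]_x I c d x = d - c.
Proof.
move=> cd; have := Rintegral_itvM (cst 1) c d.
under eq_Rintegral do rewrite mul1r.
move=> ->; rewrite Rintegral_cst// mul1r.
have mE : mu `[c, d]%classic = (if c < d then d - c else 0)%:E.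
  by rewrite lebesgue_measure_itv /= lte_fin; case: ifP.
rewrite [LHS](congr1 fine mE) /=.
by case: ltgtP cd => // -> _; rewrite subrr.
Qed.

Lemma hartley_itv0 c d : c <= d -> hartley (I c d) 0 = d - c.
Proof.
move=> cd; rewrite -Rintegral_itvE//; apply: eq_Rintegral => x _.
by rewrite /hkernel mulr0 cos0 sin0 addr0 mulr1.
Qed.

Lemma hartley_itv c d y : c < d -> y != 0 -> hartley (I c d) y =
  (sin (2 * pi * d * y) - cos (2 * pi * d * y)
   - sin (2 * pi * c * y) + cos (2 * pi * c * y)) / (2 * pi * y).
Proof.
move=> cd y0; have p0 : 0 < pi :> R := pi_gt0 R.
pose t := 2 * pi * y; have t0 : t != 0 by rewrite !mulf_neq0// gt_eqF.
pose F := fun x : R => (sin (t * x) - cos (t * x)) / t.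
have dF (x : R) : is_derive x 1 F (hkernel x y).
  have dc : is_derive x 1 (fun x : R => t * x) t.
    by apply: is_derive_eq; rewrite /GRing.scale /= ; ring.
  have d2 : is_derive x 1 (fun x : R => cos (t * x)) (- t * sin (t * x)).
    have := @is_derive1_comp R cos (fun x => t * x) x _ _ (is_derive_cos _) dc.
    by move=> H; apply: is_derive_eq; ring.
  have d3 : is_derive x 1 (fun x : R => sin (t * x)) (t * cos (t * x)).
    have := @is_derive1_comp R sin (fun x => t * x) x _ _ (is_derive_sin _) dc.
    by move=> H; apply: is_derive_eq; ring.
  rewrite /F; apply: is_derive_eq.
  rewrite /GRing.scale /= /hkernel (_ : 2 * pi * x * y = t * x); last by rewrite /t; ring.
  by field.
have cF : continuous F.
  move=> x; apply: differentiable_continuous; apply/derivable1_diffP.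
  by have [] := dF x.
transitivity (\int[mu]_(x in `[c, d]) hkernel x y).
  by rewrite -Rintegral_itvM; apply: eq_Rintegral => x _; rewrite mulrC.
rewrite /Rintegral (@continuous_FTC2 _ _ F) //.
- rewrite /= /F -mulrBl opprD opprK addrA /t.
  by congr ((sin _ - cos _ - sin _ + cos _) / _); ring.
- apply: continuous_subspaceT => x; rewrite (_ : (fun z => hkernel z y) = hkernel y).
    exact: continuous_hkernel.
  by apply/funext => z; exact: hkernelC.
- split.
  + by move=> x _; have [] := dF x.
  + by apply: cvg_at_right_filter; exact: cF.
  + by apply: cvg_at_left_filter; exact: cF.
- by move=> x _; rewrite derive1E; have [_ ->] := dF x.
Qed.

(* The Hartley kernel is not a character, but translating an interval that is
   symmetric about 0 only multiplies its transform by the kernel, because the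
   cross term is the integral of an odd function. *)
Lemma hartley_itv_translate x e y : 0 < e ->
  hartley (I (x - e) (x + e)) y = hkernel x y * hartley (I (- e) e) y.
Proof.
move=> e0; have [->|y0] := eqVneq y 0.
  rewrite !hartley_itv0; [|lra|lra].
  by rewrite /hkernel mulr0 cos0 sin0 addr0 mul1r; ring.
rewrite !hartley_itv//; [|lra|lra].
rewrite /hkernel mulrA; congr (_ / _).
rewrite (_ : 2 * pi * (x + e) * y = 2 * pi * x * y + 2 * pi * e * y); last by ring.
rewrite (_ : 2 * pi * (x - e) * y = 2 * pi * x * y - 2 * pi * e * y); last by ring.
rewrite (_ : 2 * pi * (- e) * y = - (2 * pi * e * y)); last by ring.
by rewrite !(sinD, cosD, sinB, cosB, sinN, cosN); ring.
Qed.

Lemma hartley_poisson_itv a c d y : 0 < a -> c < d ->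
  hartley (fun z => W a z * hartley (I c d) z) y =
  pi^-1 * (atan ((d - y) / a) - atan ((c - y) / a)).
Proof.
move=> a0 cd; rewrite hartley_poisson//; last exact: integrable_itv.
rewrite -Rintegral_poisson_itv// -Rintegral_itvM.
by apply: eq_Rintegral => x _; rewrite mulrC poissonC.
Qed.

Lemma cvg_atan_harmonic (t : R) : 0 < t ->
  atan (t / harmonic n) @[n --> \oo] --> (pi / 2 : R).
Proof.
move=> t0; have ty : t / harmonic n @[n --> \oo] --> +oo.
  apply/cvgryPge => M; near=> n.
  rewrite /= invrK -ler_pdivrMl// (le_trans (ler_norm _))//.
  rewrite (le_trans (ltW (archi_boundP _)))// ler_nat leqW//.
  by near: n; exact: nbhs_infty_ge.
exact: (cvg_comp _ _ ty (@cvgy_atan R)).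
Unshelve. all: by end_near. Qed.

(** Each arctangent tends to [pi / 2] or its opposite, according to the side of the endpoint on
    which [y] lies. At the endpoints themselves the limit would be 1/2, which is not the value of
    the indicator. *)
Lemma cvg_hartley_poisson_itv c d y : c < d -> y != c -> y != d ->
  hartley (fun z => W (harmonic n) z * hartley (I c d) z) y @[n --> \oo] --> I c d y.
Proof.
move=> cd yc yd; have p0 : 0 < pi :> R := pi_gt0 R.
have h0 n : 0 < harmonic n :> R by rewrite invr_gt0.
under eq_fun do rewrite hartley_poisson_itv//.
have at_neg (t : R) : t < 0 -> atan (t / harmonic n) @[n --> \oo] --> (- (pi / 2) : R).
  move=> t0; have t1 : 0 < - t by rewrite oppr_gt0.
  rewrite (_ : (fun n => atan (t / harmonic n)) = (fun n => - atan (- t / harmonic n))).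
    exact: cvgN (cvg_atan_harmonic t1).
  by apply/funext => n; rewrite mulNr atanN opprK.
have [ydl|ydg|/eqP] := ltgtP y d; last by rewrite (negbTE yd).
- have [ycl|ycg|/eqP] := ltgtP y c; last by rewrite (negbTE yc).
  + rewrite indicE memNset; last by rewrite /= in_itv /=; lra.
    rewrite (_ : false%:R = pi^-1 * (pi / 2 - pi / 2)); last by rewrite subrr mulr0.
    by apply: cvgM; [exact: cvg_cst|apply: cvgB; apply: cvg_atan_harmonic; lra].
  + rewrite indicE mem_set; last by rewrite /= in_itv /=; lra.
    rewrite (_ : true%:R = pi^-1 * (pi / 2 - - (pi / 2))); last first.
      rewrite -[LHS]/(1 : R).
      by move: p0; move: (@pi R) => p p0; field; rewrite gt_eqF.
    apply: cvgM; first exact: cvg_cst.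
    by apply: cvgB; [apply: cvg_atan_harmonic; lra|apply: at_neg; lra].
- rewrite indicE memNset; last by rewrite /= in_itv /=; lra.
  rewrite (_ : false%:R = pi^-1 * (- (pi / 2) - - (pi / 2))); last by rewrite subrr mulr0.
  by apply: cvgM; [exact: cvg_cst|apply: cvgB; apply: at_neg; lra].
Qed.

Lemma hartley_poisson_itv_le1 a c d y : 0 < a -> c < d ->
  `|hartley (fun z => W a z * hartley (I c d) z) y| <= 1.
Proof.
move=> a0 cd; have p0 : 0 < pi :> R := pi_gt0 R.
have i0 : 0 <= pi^-1 :> R by rewrite invr_ge0 ltW.
rewrite hartley_poisson_itv// normrM (ger0_norm i0).
rewrite mulrC ler_pdivrMr// mul1r ler_norml.
have := atan_gtNpi2 ((d - y) / a); have := atan_ltpi2 ((d - y) / a).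
have := atan_gtNpi2 ((c - y) / a); have := atan_ltpi2 ((c - y) / a).
by move=> *; lra.
Qed.

(** By [hartley_mul] the damped integrals [cv1] and [cv2] form one sequence, and the two sides are
    its limits. The first is dominated by [u], as smoothed indicators stay bounded by 1; the second
    by a product of two L^2 functions, by contraction. *)
Lemma Rintegral_itvM_hartley u c d : L1 u -> sqint mu u -> c < d ->
  \int[mu]_x (u x * I c d x) = \int[mu]_y (hartley u y * hartley (I c d) y).
Proof.
move=> u1 u2 cd; have i1 := integrable_itv c d.
have [Hu2 _] := hartley_contraction u1 u2.
have [HI2 _] := hartley_contraction i1 (sqint_itv c d).
have h0 n : 0 < harmonic n :> R by rewrite invr_gt0.
have W1 n := integrable_poisson_kernel (h0 n).
have WI n : L1 (fun z => W (harmonic n) z * hartley (I c d) z) := integrable_hartleyM i1 (W1 n).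
have mu1 := integrable_measurableT u1.
have cv1 : \int[mu]_x (u x * hartley (fun z => W (harmonic n) z * hartley (I c d) z) x)
    @[n --> \oo] --> \int[mu]_x (u x * I c d x).
  apply: (@Rintegral_dominated_cvg _ _ _ mu _ _ (fun x => `|u x|)).
  - by move=> n; apply: measurable_funM => //; exact: measurable_hartley.
  - by apply: measurable_funM => //; exact: measurable_fun_itv.
  (* Pointwise convergence fails only at the two endpoints. *)
  - have neg1 z : mu.-negligible [set z].
      by apply/negligibleP; [exact: measurable_set1|exact: lebesgue_measure_set1].
    apply: negligibleS (negligibleU (neg1 c) (neg1 d)).
    move=> y /= ny; apply: contrapT => ycd; apply: ny; apply: cvgM; first exact: cvg_cst.
    apply: cvg_hartley_poisson_itv => //; apply/eqP => yE; apply: ycd; [by left|by right].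
  - exact: integrable_norm.
  - by move=> n x; rewrite normrM ler_piMr// hartley_poisson_itv_le1.
have cv2 : \int[mu]_y (hartley u y * (W (harmonic n) y * hartley (I c d) y))
    @[n --> \oo] --> \int[mu]_y (hartley u y * hartley (I c d) y).
  have H1 := sqintM Hu2 HI2.
  apply: (@Rintegral_dominated_cvg _ _ _ mu _ _ (fun y => `|hartley u y * hartley (I c d) y|)).
  - move=> n; apply: measurable_funM; first exact: measurable_hartley.
    exact: integrable_measurableT (WI n).
  - exact: integrable_measurableT H1.
  - apply: aeW => y; apply: cvgM; first exact: cvg_cst.
    rewrite -[X in _ --> X]mul1r; apply: cvgM; last exact: cvg_cst.
    exact: cvg_poisson_kernel.
  - exact: integrable_norm.
  - move=> n y; rewrite mulrCA normrM ler_piMl// ger0_norm ?expR_ge0//.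
    exact: poisson_kernel_le1.
apply: (cvg_unique _ cv1) => //.
rewrite (_ : (fun n => _) = (fun n => \int[mu]_y (hartley u y * (W (harmonic n) y * hartley (I c d) y)))) //.
by apply/funext => n; rewrite -hartley_mul.
Qed.

End intervals.

(** * From interval averages to functions: the reverse inequality and band-limiting *)

Section inversion.
Context (R : realType).
Local Notation mu := (@lebesgue_measure R).
Local Notation L1 f := (mu.-integrable [set: R] (EFin \o f)).
Local Notation I c d := (\1_(`[c, d]%classic) : R -> R).
Implicit Types (u v f g : R -> R) (a c d x y : R).

Lemma sqint_integrable_itv f c d : sqint mu f -> mu.-integrable `[c, d] (EFin \o f).
Proof.
move=> f2; have := sqintM f2 (sqint_itv c d) => i1.
apply/integrable_mkcond => //; apply: eq_integrable i1 => // x _ /=.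
by rewrite patchE indicE; case: (_ \in _); rewrite ?mulr1 ?mulr0.
Qed.

(** On a compact set, [f] is dominated by [1 + f ^+ 2]. *)
Lemma sqint_locally_integrable f : sqint mu f -> locally_integrable setT f.
Proof.
move=> [mf f2]; split => //; first exact: openT.
move=> K _ cK; have mK : measurable (K : set (measurableTypeR R)) by exact: compact_measurable.
have K1 : mu.-integrable K (EFin \o (fun x => 1 + f x ^+ 2)).
  have := @integrableD _ _ _ mu K mK (cst 1%:E) (EFin \o (fun x => f x ^+ 2)).
  apply; last by apply: (integrableS measurableT).
  apply/integrableP; split; first exact: measurable_cst.
  under eq_integral do rewrite /= normr1.
  by rewrite integral_cst// mul1e; exact: compact_finite_measure.
apply: (@le_lt_trans _ _ (\int[mu]_(x in K) (1 + f x ^+ 2)%:E)%E); last first.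
  by have := integrable_lty mK K1.
apply: ge0_le_integral => //.
- by apply/measurable_EFinP; apply: measurableT_comp => //; exact: measurable_funTS.
- exact: measurable_int K1.
- move=> x _; rewrite lee_fin -(real_normK (num_real (f x))).
  by have := sqr_ge0 (`|f x| - 1); have := normr_ge0 (f x); nra.
Qed.

Let Eh x (n : nat) : set R := `[x - harmonic n, x + harmonic n]%classic.

Let h0 n : 0 < harmonic n :> R. Proof. by rewrite invr_gt0. Qed.

Let mu_Eh x n : mu (Eh x n) = (2 * harmonic n)%:E.
Proof.
move: (h0 n); rewrite /Eh; move: (harmonic n : R) => h hn.
rewrite lebesgue_measure_itv /= lte_fin ifT; last by lra.
by rewrite -EFinB; congr EFin; ring.
Qed.

Let nicely_shrinking_Eh x : nicely_shrinking x (Eh x).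
Proof.
split; first by move=> n; exact: measurable_itv.
have r0 n : 0 < 2 * harmonic n :> R by rewrite mulr_gt0.
(* The closed interval of half-width [h] does not fit in the open ball of radius [h], so the radius
   is doubled; the ball then has measure [4 h], twice that of the interval. *)
exists (2, fun n => PosNum (r0 n)); split => //=.
- rewrite -(mulr0 2); apply: cvgM; [exact: cvg_cst|exact: cvg_harmonic].
- move=> n y; have := h0 n; rewrite /Eh /= in_itv /= ball_itv /= in_itv /=.
  by move: (n.+1%:R^-1 : R) => h hn /andP[? ?]; apply/andP; split; lra.
- move=> n; rewrite mu_Eh lebesgue_measure_ball; last exact: (ltW (r0 n)).
  rewrite -EFinM lee_fin.
  by rewrite [leRHS]mulr_natl.
Qed.

Lemma lebesgue_differentiation_sqint f : sqint mu f ->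
  {ae mu, forall x, (2 * harmonic n)^-1 *
     \int[mu]_y (f y * I (x - harmonic n) (x + harmonic n) y) @[n --> \oo] --> f x}.
Proof.
move=> f2; have lf := sqint_locally_integrable f2.
apply: (@filterS _ _ (ae_filter_ringOfSetsType mu)) (lebesgue_differentiation lf) => x fx.
have := nice_lebesgue_differentiation nicely_shrinking_Eh lf fx.
move=> /fine_cvg; apply: cvg_trans; apply: near_eq_cvg; apply: nearW => n /=.
rewrite Rintegral_itvM mu_Eh inver gt_eqF ?mulr_gt0// fineM//.
exact: integrable_fin_num (sqint_integrable_itv _ _ f2).
Qed.

(* The averages of D over [x - h, x + h] are the Hartley transform of G times
   that of [-h, h], so contraction and Fatou's lemma bound the norm of D. *)
Lemma sqint_hartley_itv_le (D G : R -> R) : sqint mu D -> sqint mu G ->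
  (forall c d, c < d ->
    \int[mu]_x (D x * I c d x) = \int[mu]_y (G y * hartley (I c d) y)) ->
  \int[mu]_x D x ^+ 2 <= 4 * \int[mu]_y G y ^+ 2.
Proof.
move=> D2 G2 DG; pose h n : R := harmonic n.
pose k n := hartley (I (- h n) (h n)).
have i1 n : L1 (I (- h n) (h n)) := integrable_itv _ _.
(* The kernel bound 2 times the length [2 h]. Dividing by the [2 h] of the average leaves 2, whose
   square is the constant 4 of the statement. *)
have k4 n y : `|k n y| <= 4 * h n.
  rewrite (le_trans (hartley_le y (i1 n)))//.
  rewrite (_ : \int[mu]_x `|I (- h n) (h n) x| = h n - - h n); first by lra.
  rewrite -Rintegral_itvE; last by have := h0 n; rewrite /h; lra.
  by apply: eq_Rintegral => x _; rewrite indicE; case: (_ \in _); rewrite ?normr1 ?normr0.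
have mk n : measurable_fun setT (k n) by exact: measurable_hartley.
have k2 n : sqint mu (k n).
  by have [] := hartley_contraction (i1 n) (sqint_itv (- h n) (h n)).
have Gk1 n : L1 (fun y => G y * k n y) by exact: sqintM.
have Gk2 n : sqint mu (fun y => G y * k n y) by exact: sqintMb G2 (mk n) (k4 n).
have avgE n x : (2 * h n)^-1 * \int[mu]_y (D y * I (x - h n) (x + h n) y) =
    (2 * h n)^-1 * hartley (fun y => G y * k n y) x.
  congr (_ * _); rewrite DG; last by have := h0 n; rewrite /h; lra.
  apply: eq_Rintegral => y _.
  by rewrite hartley_itv_translate ?h0// -/(k n) (hkernelC y); ring.
have sH n : sqint mu (fun x => (2 * h n)^-1 * hartley (fun y => G y * k n y) x).
  by apply: sqintZ; have [] := hartley_contraction (Gk1 n) (Gk2 n).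
have mD : measurable_fun setT D by case: D2.
have [||||||//] := @Rintegral_fatou _ _ _ mu
  (fun n x => ((2 * h n)^-1 * hartley (fun y => G y * k n y) x) ^+ 2)
  (fun x => D x ^+ 2) (4 * \int[mu]_y G y ^+ 2).
- by move=> n; case: (sH n).
- by move=> n x; exact: sqr_ge0.
- exact: measurable_funX.
- by move=> x; exact: sqr_ge0.
- apply: (@filterS _ _ (ae_filter_ringOfSetsType mu)) (lebesgue_differentiation_sqint D2) => x Dx.
  under eq_fun do rewrite -avgE.
  by rewrite expr2; under eq_fun do rewrite expr2; exact: cvgM.
move=> n.
have [[mHG HG2] HGle] := hartley_contraction (Gk1 n) (Gk2 n).
under eq_Rintegral do rewrite exprMn.
rewrite RintegralZl//.
have hn : 0 < h n := h0 n.
have le1 : \int[mu]_y (G y * k n y) ^+ 2 <= (4 * h n) ^+ 2 * \int[mu]_y G y ^+ 2.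
  have [mG G2'] := G2; have [_ GK2'] := Gk2 n.
  rewrite -RintegralZl//; apply: le_Rintegral => //; first exact: integrableZT.
  move=> y _; rewrite exprMn mulrC ler_wpM2r ?sqr_ge0//.
  by rewrite -(real_normK (num_real (k n y))) lerXn2r ?nnegrE// ?(le_trans _ (k4 n y)).
have le2 := le_trans HGle le1.
rewrite exprVn mulrC ler_pdivrMr ?exprn_gt0 ?mulr_gt0//.
by apply: (le_trans le2); rewrite le_eqVlt; apply/orP; left; apply/eqP; ring.
Qed.

(* The graph of the closure in L^2 of the Hartley transform on L^1 /\ L^2. *)
Definition hartley_pair f g := [/\ sqint mu f, sqint mu g &
  exists u : nat -> R -> R, [/\ forall n, L1 (u n) /\ sqint mu (u n),
    \int[mu]_x (u n x - f x) ^+ 2 @[n --> \oo] --> 0 &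
    \int[mu]_x (hartley (u n) x - g x) ^+ 2 @[n --> \oo] --> 0]].

(** [hartley_mul] holds along the approximating sequence, and both sides are continuous in L^2. *)
Lemma hartley_pair_mul f g v : hartley_pair f g -> L1 v -> sqint mu v ->
  \int[mu]_y (g y * v y) = \int[mu]_x (f x * hartley v x).
Proof.
move=> [f2 g2 [u [u12 uf ug]]] v1 v2; have [Hv2 _] := hartley_contraction v1 v2.
have Hu2 n : sqint mu (hartley (u n)).
  by have [u1 u2] := u12 n; have [] := hartley_contraction u1 u2.
have cf := cvg_Rintegral_sqint (fun n => (u12 n).2) f2 Hv2 uf.
have cg := cvg_Rintegral_sqint Hu2 g2 v2 ug.
apply: (cvg_unique _ cg) => //.
rewrite (_ : (fun n => _) = (fun n => \int[mu]_x (u n x * hartley v x)))//.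
by apply/funext => n; rewrite hartley_mul//; case: (u12 n).
Qed.

Lemma hartley_pair_itv f g c d : hartley_pair f g -> c < d ->
  \int[mu]_x (f x * I c d x) = \int[mu]_y (g y * hartley (I c d) y).
Proof.
move=> [f2 g2 [u [u12 uf ug]]] cd; have i2 := sqint_itv c d.
have [Hi2 _] := hartley_contraction (integrable_itv c d) i2.
have Hu2 n : sqint mu (hartley (u n)).
  by have [u1 u2] := u12 n; have [] := hartley_contraction u1 u2.
have cf := cvg_Rintegral_sqint (fun n => (u12 n).2) f2 i2 uf.
have cg := cvg_Rintegral_sqint Hu2 g2 Hi2 ug.
apply: (cvg_unique _ cf) => //.
rewrite (_ : (fun n => _) = (fun n => \int[mu]_y (hartley (u n) y * hartley (I c d) y)))//.
by apply/funext => n; have [u1 u2] := u12 n; rewrite Rintegral_itvM_hartley.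
Qed.

(** The Hartley transform is its own inverse, so if [g] is the transform of [f], this is the part of
    [f] with frequencies in [-M, M]. The truncation makes [g] integrable. *)
Definition band M g := hartley (fun y => g y * I (- M) M y).

Lemma sqint_band M g : sqint mu g -> sqint mu (band M g).
Proof.
move=> g2; have gM1 := sqintM g2 (sqint_itv (- M) M).
have gM2 := sqintMb g2 (measurable_fun_itv (- M) M) (itv_le1 (- M) M).
by have [] := hartley_contraction gM1 gM2.
Qed.

(** [sqint_hartley_itv_le] for the two differences: the interval identity holds for [f] and [g] by
    [hartley_pair_itv], and for the truncated pair by [hartley_mul]. *)
Lemma hartley_pair_band_le f g M : hartley_pair f g ->
  \int[mu]_x (f x - band M g x) ^+ 2 <=
  4 * \int[mu]_y (g y - g y * I (- M) M y) ^+ 2.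
Proof.
move=> fg; have [f2 g2 _] := fg.
have gM1 := sqintM g2 (sqint_itv (- M) M).
have gM2 := sqintMb g2 (measurable_fun_itv (- M) M) (itv_le1 (- M) M).
have s2 := sqint_band M g2.
apply: sqint_hartley_itv_le; [exact: sqintB|exact: sqintB|move=> c d cd].
have i2 := sqint_itv c d; have i1 := integrable_itv c d.
have [Hi2 _] := hartley_contraction i1 i2.
transitivity (\int[mu]_x (f x * I c d x) - \int[mu]_x (band M g x * I c d x)).
  rewrite -RintegralB//; [|exact: sqintM..].
  by apply: eq_Rintegral => x _; rewrite mulrBl.
rewrite (hartley_pair_itv fg cd) hartley_mul// -RintegralB//; [|exact: sqintM..].
by apply: eq_Rintegral => x _; rewrite mulrBl.
Qed.

(** The sinc kernel centred at [x], kept in the form of a transform so that contraction bounds its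
    norm. *)
Definition band_kernel M x := hartley (fun y => hkernel x y * I (- M) M y).

Let sqint_hkernel_itv M x : L1 (fun y => hkernel x y * I (- M) M y) /\
  sqint mu (fun y => hkernel x y * I (- M) M y).
Proof.
have mk := @measurable_hkernel R x; have i1 := integrable_itv (- M) M.
under eq_fun do rewrite mulrC; split.
  by apply: (integrableMbT i1 mk) => y; exact: hkernel_le2.
by apply: (sqintMb (sqint_itv (- M) M) mk) => y; exact: hkernel_le2.
Qed.

Lemma sqint_band_kernel M x : sqint mu (band_kernel M x).
Proof.
by have [k1 k2] := sqint_hkernel_itv M x; have [] := hartley_contraction k1 k2.
Qed.

(** The squared Hartley kernel is at most 4, on an interval of length [2 * M]. *)
Lemma band_kernel_le M x : 0 <= M -> \int[mu]_y band_kernel M x y ^+ 2 <= 8 * M.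
Proof.
move=> M0; have [k1 k2] := sqint_hkernel_itv M x.
have [_ le1] := hartley_contraction k1 k2; apply: (le_trans le1).
have -> : 8 * M = 4 * \int[mu]_y I (- M) M y by rewrite Rintegral_itvE; [ring|lra].
have i1 := integrable_itv (- M) M; have [_ k2'] := k2.
rewrite -RintegralZl//; apply: le_Rintegral => //; first exact: integrableZT.
move=> y _; rewrite indicE; case: (_ \in _) => /=; rewrite ?mulr0 ?mulr1 ?expr0n//.
rewrite -(real_normK (num_real (hkernel x y))).
by have := hkernel_le2 x y; have := normr_ge0 (hkernel x y); nra.
Qed.

(** Writes the value at a point as an inner product with [f], to which Bessel's inequality
    applies. *)
Lemma hartley_pair_bandE f g M x : hartley_pair f g ->
  band M g x = \int[mu]_y (f y * band_kernel M x y).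
Proof.
move=> fg; have [k1 k2] := sqint_hkernel_itv M x.
rewrite -(hartley_pair_mul fg k1 k2); apply: eq_Rintegral => y _.
by rewrite (hkernelC x); ring.
Qed.

End inversion.

(** * Counting by Bessel's inequality *)

Section counting.
Context (R : realType).
Local Notation mu := (@lebesgue_measure R).
Local Notation L1 f := (mu.-integrable [set: R] (EFin \o f)).
Local Notation I c d := (\1_(`[c, d]%classic) : R -> R).
Implicit Types (f g : R -> R) (M r x y : R).

Lemma ae_le_Rintegral f g : L1 f -> L1 g -> {ae mu, forall x, f x <= g x} ->
  \int[mu]_x f x <= \int[mu]_x g x.
Proof.
move=> f1 g1 fg; rewrite -subr_ge0 -RintegralB//.
have d1 := integrableBT g1 f1; have md := integrable_measurableT d1.
have -> : \int[mu]_x (g x - f x) = \int[mu]_x `|g x - f x|.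
  rewrite /Rintegral; congr fine; apply: ae_eq_integral => //.
  - exact/measurable_EFinP.
  - by apply/measurable_EFinP; exact: measurableT_comp.
  - apply: (@filterS _ _ (ae_filter_ringOfSetsType mu)) fg => x fgx _.
    by rewrite ger0_norm// subr_ge0.
by apply: Rintegral_ge0.
Qed.

Lemma sqint_sum (J : finType) (c : J -> R) (f : J -> R -> R) (w : R -> R) :
  (forall i, sqint mu (f i)) -> sqint mu w ->
  sqint mu (fun x => \sum_i c i * f i x) /\
  \int[mu]_x ((\sum_i c i * f i x) * w x) = \sum_i c i * \int[mu]_x (f i x * w x).
Proof.
move=> f2 w2; elim: index_enum => [|i s [s2 IH]].
  split; first by under eq_fun do rewrite big_nil;
    split; [exact: measurable_cst|under eq_fun do rewrite expr0n; exact: integrable0].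
  rewrite big_nil; under eq_Rintegral do rewrite big_nil mul0r.
  by rewrite Rintegral_cst// mul0r.
have ci2 := sqintZ (c i) (f2 i).
split; first by under eq_fun do rewrite big_cons; exact: sqintD.
rewrite big_cons -IH -RintegralZl//; last exact: sqintM.
rewrite -RintegralD//; [|by apply: integrableZT; exact: sqintM|exact: sqintM].
by apply: eq_Rintegral => x _; rewrite big_cons; ring.
Qed.

(** Bessel's inequality for the orthonormal pairs [(p i, q i)] in L^2(R; R^2), tested on [(K, 0)].
    The projection of [(K, 0)] is [(S, T)], and its squared norm is the sum of the [c i ^+ 2];
    expanding the norm of [K - S] and discarding that of [T] suffices. *)
Lemma bessel_pair (J : finType) (p q : J -> R -> R) (K : R -> R) :
  (forall i, sqint mu (p i)) -> (forall i, sqint mu (q i)) -> sqint mu K ->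
  (forall i j, \int[mu]_x (p i x * p j x) + \int[mu]_x (q i x * q j x) = (i == j)%:R) ->
  \sum_i (\int[mu]_x (p i x * K x)) ^+ 2 <= \int[mu]_x K x ^+ 2.
Proof.
move=> p2 q2 K2 pq.
have fin (k s a b : R) : 0 <= k - 2 * s + a -> 0 <= b -> a + b = s -> s <= k.
  by move=> *; lra.
pose c i := \int[mu]_x (p i x * K x).
pose S x := \sum_i c i * p i x; pose T x := \sum_i c i * q i x.
have [S2 SK] := sqint_sum c p2 K2.
have [T2 _] := sqint_sum c q2 K2.
have ES w : sqint mu w -> \int[mu]_x (S x * w x) = \sum_i c i * \int[mu]_x (p i x * w x).
  by move=> w2; have [] := sqint_sum c p2 w2.
have ET w : sqint mu w -> \int[mu]_x (T x * w x) = \sum_i c i * \int[mu]_x (q i x * w x).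
  by move=> w2; have [] := sqint_sum c q2 w2.
have SS : \int[mu]_x S x ^+ 2 + \int[mu]_x T x ^+ 2 = \sum_i c i ^+ 2.
  under eq_Rintegral do rewrite expr2; under [X in _ + X]eq_Rintegral do rewrite expr2.
  rewrite ES// ET// -big_split /=; apply: eq_bigr => i _.
  rewrite -mulrDr expr2; congr (_ * _).
  under eq_Rintegral do rewrite mulrC; under [X in _ + X]eq_Rintegral do rewrite mulrC.
  rewrite ES// ET// -big_split /= (bigD1 i)//= big1 ?addr0; last first.
    by move=> j ji; rewrite -mulrDr pq (negbTE ji) mulr0.
  by rewrite -mulrDr pq eqxx mulr1.
have := Rintegral_sqr_ge0 mu (fun x => K x - 1 * S x).
rewrite Rintegral_sqrBZ// mulr1 expr1n mul1r.
have -> : \int[mu]_x (K x * S x) = \sum_i c i ^+ 2.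
  under eq_Rintegral do rewrite mulrC.
  by rewrite ES//; apply: eq_bigr => i _; rewrite expr2.
by move=> h1; exact: fin h1 (Rintegral_sqr_ge0 mu T) SS.
Qed.

Lemma sqint_tail f e : sqint mu f -> 0 < e ->
  exists2 r, 0 < r & \int[mu]_x (f x - f x * I (- r) r x) ^+ 2 <= e.
Proof.
move=> [mf f2] e0; pose F (n : nat) x := (f x - f x * I (- n%:R) n%:R x) ^+ 2.
have FE n x : F n x = if x \in `[- n%:R, n%:R]%classic then 0 else f x ^+ 2.
  by rewrite /F indicE; case: ifP => _; rewrite ?mulr1 ?subrr ?expr0n// mulr0 subr0.
have cv : \int[mu]_x F n x @[n --> \oo] --> \int[mu]_x (cst 0 x).
  apply: (@Rintegral_dominated_cvg _ _ _ mu _ _ (fun x => f x ^+ 2)) => //.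
  - move=> n; apply: measurable_funX; apply: measurable_funB => //.
    by apply: measurable_funM => //; exact: measurable_fun_itv.
  - apply: aeW => x; apply: cvg_near_cst; near=> n.
    rewrite FE mem_set//= in_itv /= -ler_norml.
    rewrite (le_trans (ltW (archi_boundP (normr_ge0 x))))// ler_nat.
    by near: n; exact: nbhs_infty_ge.
  - by move=> n x; rewrite FE; case: ifP => _; rewrite ger0_norm ?sqr_ge0.
rewrite Rintegral_cst// mul0r in cv.
(* [N.+1] rather than [N], so that the radius is positive. *)
move/cvgr0Pnorm_le : cv => /(_ e e0) [N _ /(_ N.+1)].
rewrite /= => /(_ (leqnSn _)) H; exists N.+1%:R => //.
by apply: le_trans H; exact: ler_norm.
Unshelve. all: by end_near. Qed.

(** With [s] the band-limited part, [f ^+ 2 <= 2 * s ^+ 2 + 2 * (f - s) ^+ 2], the difference of the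
    two sides being [(f - 2 * s) ^+ 2]. The norm of [f - s] costs a factor 4, whence the 8. *)
Lemma hartley_pair_mass f g Psi M r : hartley_pair f g -> sqint mu Psi ->
  {ae mu, forall y, `|g y| <= Psi y} ->
  \int[mu]_x (f x ^+ 2 * I (- r) r x) <=
  2 * \int[mu]_x (band M g x ^+ 2 * I (- r) r x) +
  8 * \int[mu]_y (Psi y - Psi y * I (- M) M y) ^+ 2.
Proof.
move=> fg P2 gP; have [f2 g2 _] := fg; have s2 := sqint_band M g2.
have cut c h : sqint mu h -> sqint mu (fun y => h y - h y * I (- c) c y).
  move=> h2; apply: sqintB => //.
  exact: sqintMb h2 (measurable_fun_itv (- c) c) (itv_le1 (- c) c).
have le1 := hartley_pair_band_le M fg.
have le2 : \int[mu]_y (g y - g y * I (- M) M y) ^+ 2 <=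
    \int[mu]_y (Psi y - Psi y * I (- M) M y) ^+ 2.
  apply: ae_le_Rintegral; [by case: (cut M g g2)|by case: (cut M Psi P2)|].
  apply: (@filterS _ _ (ae_filter_ringOfSetsType mu)) gP => y gy.
  rewrite indicE; case: (_ \in _); rewrite ?mulr1 ?subrr// !mulr0 !subr0.
  by rewrite -(real_normK (num_real (g y))) lerXn2r ?nnegrE// (le_trans _ gy).
have cut1 h : sqint mu h -> L1 (fun x => h x ^+ 2 * I (- r) r x).
  move=> [mh h2].
  exact: integrableMbT h2 (measurable_fun_itv (- r) r) (itv_le1 (- r) r).
have fs2 := sqintB f2 s2; have [_ fs2'] := fs2.
have le3 : \int[mu]_x (f x ^+ 2 * I (- r) r x) <=
    2 * \int[mu]_x (band M g x ^+ 2 * I (- r) r x) +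
    2 * \int[mu]_x (f x - band M g x) ^+ 2.
  have c1 := cut1 _ s2.
  rewrite -!RintegralZl// -RintegralD//; [|exact: integrableZT..].
  apply: le_Rintegral => //.
  - exact: cut1.
  - by apply: integrableDT; exact: integrableZT.
  - move=> x _; rewrite indicE; have := sqr_ge0 (f x - 2 * band M g x).
    by have := sqr_ge0 (f x - band M g x); case: (_ \in _) => /=; rewrite ?mulr1 ?mulr0; nra.
by move: le1 le2 le3; lra.
Qed.

(** The bound for finite families, with [p i] and [q i] the real and imaginary parts of the
    functions, and [g i] and [h i] their Hartley transforms. *)
Lemma hartley_umbrella (Phi Psi : R -> R) : sqint mu Phi -> sqint mu Psi ->
  exists N : nat, forall (n : nat) (p q g h : 'I_n -> R -> R),
    (forall i, hartley_pair (p i) (g i)) -> (forall i, hartley_pair (q i) (h i)) ->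
    (forall i j, \int[mu]_x (p i x * p j x) + \int[mu]_x (q i x * q j x) = (i == j)%:R) ->
    (forall i, {ae mu, forall x, p i x ^+ 2 + q i x ^+ 2 <= Phi x ^+ 2}) ->
    (forall i, {ae mu, forall y, `|g i y| <= Psi y}) ->
    (forall i, {ae mu, forall y, `|h i y| <= Psi y}) -> (n <= N)%N.
Proof.
move=> P2 Q2.
(* With tails 1/4 and 1/64 one has [1 <= 2 * (s + t) + 16 / 64 + 1 / 4], which leaves mass 1/4 for
   the band-limited functions. *)
have fin1 (s t pA qA d e : R) : 1 <= pA + qA + d -> d <= 4^-1 -> e <= 64^-1 ->
    pA <= 2 * s + 8 * e -> qA <= 2 * t + 8 * e -> 4^-1 <= s + t.
  by move=> *; lra.
have fin2 (s t k b : R) : s <= k -> t <= k -> k <= 8 * b -> s + t <= 16 * b.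
  by move=> *; lra.
have fin3 (n s b : R) : n * 4^-1 <= s -> s <= 16 * b -> n <= 64 * b.
  by move=> *; lra.
have [r r0 Pr] := @sqint_tail _ (4^-1) P2 ltac:(lra).
have [M M0 QM] := @sqint_tail _ (64^-1) Q2 ltac:(lra).
(* Each index contributes at least 1/4 to a total of at most [16 * M] times the length [2 * r]. *)
exists (Num.bound (128 * M * r)) => n p q g h pg qh pq pqP gQ hQ.
have p2 i : sqint mu (p i) by case: (pg i).
have q2 i : sqint mu (q i) by case: (qh i).
pose A : R -> R := I (- r) r.
have mA : measurable_fun setT A by exact: measurable_fun_itv.
have A1 : forall x, `|A x| <= 1 by exact: itv_le1.
have cut1 f : sqint mu f -> L1 (fun x => f x ^+ 2 * A x).
  by move=> [mf f2]; exact: integrableMbT f2 mA A1.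
have s2 i : sqint mu (band M (g i)) by apply: sqint_band; case: (pg i).
have t2 i : sqint mu (band M (h i)) by apply: sqint_band; case: (qh i).
pose m i := \int[mu]_x (band M (g i) x ^+ 2 * A x) + \int[mu]_x (band M (h i) x ^+ 2 * A x).
have mass i : 4^-1 <= m i.
  have one : \int[mu]_x p i x ^+ 2 + \int[mu]_x q i x ^+ 2 = 1.
    have := pq i i; rewrite eqxx.
    by under eq_Rintegral do rewrite -expr2; under [X in _ + X]eq_Rintegral do rewrite -expr2.
  have [_ p2'] := p2 i; have [_ q2'] := q2 i.
  have tail : \int[mu]_x p i x ^+ 2 + \int[mu]_x q i x ^+ 2 <=
      \int[mu]_x (p i x ^+ 2 * A x) + \int[mu]_x (q i x ^+ 2 * A x) +
      \int[mu]_x (Phi x - Phi x * A x) ^+ 2.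
    have [_ PA] : sqint mu (fun x => Phi x - Phi x * A x).
      by apply: sqintB => //; exact: sqintMb P2 mA A1.
    have pA := cut1 _ (p2 i); have qA := cut1 _ (q2 i).
    rewrite -!RintegralD//; last exact: integrableDT.
    apply: ae_le_Rintegral; [exact: integrableDT|by apply: integrableDT => //; exact: integrableDT|].
    apply: (@filterS _ _ (ae_filter_ringOfSetsType mu)) (pqP i) => x pqx.
    rewrite /A indicE; case: (_ \in _); rewrite ?mulr1 ?subrr ?expr0n /= ?addr0//.
    by rewrite !mulr0 subr0 !add0r.
  rewrite one in tail.
  exact: fin1 tail Pr QM (hartley_pair_mass M r (pg i) Q2 (gQ i))
    (hartley_pair_mass M r (qh i) Q2 (hQ i)).
have bes x : \sum_i (band M (g i) x ^+ 2) + \sum_i (band M (h i) x ^+ 2) <= 16 * M.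
  have K2 := sqint_band_kernel M x.
  have K8 := band_kernel_le x (ltW M0).
  have b1 := bessel_pair p2 q2 K2 pq.
  (* The orthonormality relation is symmetric in the two components, so Bessel's inequality also
     holds with [(0, K)]. *)
  have b2 : \sum_i (\int[mu]_y (q i y * band_kernel M x y)) ^+ 2 <=
      \int[mu]_y band_kernel M x y ^+ 2.
    by apply: (bessel_pair q2 p2 K2) => i j; rewrite addrC.
  under eq_bigr do rewrite (hartley_pair_bandE M x (pg _)).
  under [X in _ + X]eq_bigr do rewrite (hartley_pair_bandE M x (qh _)).
  exact: fin2 b1 b2 K8.
have total : \sum_i m i <= 16 * M * (2 * r).
  have iA : L1 A := integrable_itv _ _.
  have mE : \sum_i m i = \int[mu]_x (\sum_i (band M (g i) x ^+ 2 * A x + band M (h i) x ^+ 2 * A x)).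
    rewrite /Rintegral; under eq_integral do rewrite -sumEFin.
    rewrite integral_sum//; last first.
      by move=> i; apply: integrableDT; exact: cut1.
    rewrite -sum_fine; last first.
      by move=> i _; apply: integrable_fin_num => //; apply: integrableDT; exact: cut1.
    by apply: eq_bigr => i _; rewrite -[RHS]/(Rintegral _ _ _) RintegralD//; exact: cut1.
  have -> : 2 * r = \int[mu]_x A x.
    by rewrite Rintegral_itvE ?opprK ?mulr_natl// ge0_cp// ltW.
  rewrite mE -RintegralZl//; apply: le_Rintegral => //.
  - have iS : mu.-integrable setT
        (fun x => (\sum_i (band M (g i) x ^+ 2 * A x + band M (h i) x ^+ 2 * A x)%:E)%E).
      by apply: integrable_sum => // i _; apply: integrableDT; exact: cut1.
    by apply: eq_integrable iS => // x _ /=; rewrite sumEFin.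
  - exact: integrableZT.
  - move=> x _; rewrite big_split /= -!mulr_suml -mulrDl.
    have A0 : 0 <= A x by rewrite /A indicE.
    exact: ler_wpM2r A0 _ _ (bes x).
have : n%:R * 4^-1 <= \sum_i m i.
  rewrite -[X in X%:R]card_ord mulr_natl -sumr_const.
  by apply: ler_sum => i _; exact: mass.
move=> low; rewrite -(ler_nat R).
have b0 : 0 <= 128 * M * r by rewrite !mulr_ge0// ltW.
apply/ltW/(le_lt_trans _ (archi_boundP b0)).
rewrite (_ : 128 * M * r = 64 * (M * (2 * r))); last by ring.
have total2 : \sum_i m i <= 16 * (M * (2 * r)) by rewrite [leRHS]mulrA.
exact: (fin3 _ _ _ low total2).
Qed.

End counting.

(** * From the Fourier to the Hartley transform *)

Section complex.
Context (R : realType).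
Local Notation mu := (@lebesgue_measure R).
Local Notation L1 f := (mu.-integrable [set: R] (EFin \o f)).
Local Notation Re := (@complex.Re R).
Local Notation Im := (@complex.Im R).
Implicit Types (f g u : R -> R[i]) (x y : R) (z : R[i]).

Lemma Lfun2_sqint (f : R -> R) : f \in Lfun mu 2%:E -> sqint mu f.
Proof.
move=> f2; split; last exact: Lfun2_integrable_sqr.
by move: f2 => /[!inE] /andP[/[!inE]].
Qed.

Lemma Lcfun2_sqint f : Lcfun 2%:E f -> sqint mu (Re \o f) /\ sqint mu (Im \o f).
Proof. by case=> ? ?; split; exact: Lfun2_sqint. Qed.

Lemma Lcfun1_integrable f : Lcfun 1%:E f -> L1 (Re \o f) /\ L1 (Im \o f).
Proof. by case=> ? ?; split; exact/Lfun1_integrable. Qed.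

(** Cauchy-Schwarz against the unit vector with entries 1/2, 1/2, 1/2, -1/2. *)
Lemma sqr_half_sum_le (p q r s : R) :
  (2^-1 * (p + q + r - s)) ^+ 2 <= p ^+ 2 + s ^+ 2 + (q ^+ 2 + r ^+ 2).
Proof.
rewrite -subr_ge0 (_ : _ - _ = 4^-1 * ((p - q) ^+ 2 + (p - r) ^+ 2 + (p + s) ^+ 2 +
  (q - r) ^+ 2 + (q + s) ^+ 2 + (r + s) ^+ 2)); last by field.
by rewrite mulr_ge0// ?invr_ge0// !addr_ge0 ?sqr_ge0.
Qed.

Lemma ReM z w : Re (z * w) = Re z * Re w - Im z * Im w.
Proof. by case: z w => [? ?] [? ?]. Qed.

Lemma ImM z w : Im (z * w) = Re z * Im w + Im z * Re w.
Proof. by case: z w => [? ?] [? ?]. Qed.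

Lemma normcE z : normc z = Num.sqrt (Re z ^+ 2 + Im z ^+ 2).
Proof. by case: z. Qed.

Lemma sqr_normc z : normc z ^+ 2 = Re z ^+ 2 + Im z ^+ 2.
Proof. by rewrite normcE sqr_sqrtr// addr_ge0 ?sqr_ge0. Qed.

Lemma normc_ge0 z : 0 <= normc z.
Proof. by rewrite normcE sqrtr_ge0. Qed.

Lemma Re_le_normc z : `|Re z| <= normc z.
Proof. by rewrite normcE -sqrtr_sqr ler_wsqrtr// lerDl sqr_ge0. Qed.

Lemma Im_le_normc z : `|Im z| <= normc z.
Proof. by rewrite normcE -sqrtr_sqr ler_wsqrtr// lerDr sqr_ge0. Qed.

(* The Hartley transforms of the real and imaginary parts of f, in terms of the
   Fourier transform g of f. *)
Definition hartley_Re g y : R :=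
  2^-1 * (Re (g y) + Re (g (- y)) + Im (g (- y)) - Im (g y)).
Definition hartley_Im g y : R :=
  2^-1 * (Im (g y) + Im (g (- y)) + Re (g y) - Re (g (- y))).

Lemma hartley_Re_le g y : `|hartley_Re g y| <= normc (g y) + normc (g (- y)).
Proof.
have := Re_le_normc (g y); have := Im_le_normc (g y).
have := Re_le_normc (g (- y)); have := Im_le_normc (g (- y)).
rewrite /hartley_Re !ler_norml => /andP[? ?] /andP[? ?] /andP[? ?] /andP[? ?].
by apply/andP; split; lra.
Qed.

Lemma hartley_Im_le g y : `|hartley_Im g y| <= normc (g y) + normc (g (- y)).
Proof.
have := Re_le_normc (g y); have := Im_le_normc (g y).
have := Re_le_normc (g (- y)); have := Im_le_normc (g (- y)).
rewrite /hartley_Im !ler_norml => /andP[? ?] /andP[? ?] /andP[? ?] /andP[? ?].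
by apply/andP; split; lra.
Qed.

(** The cosine and sine integrals of a real function are the even and odd parts of its Hartley
    transform. *)
Lemma fourierE u y : Lcfun 1%:E u ->
  Re (fourier u y) = 2^-1 * (hartley (Re \o u) y + hartley (Re \o u) (- y) +
                             hartley (Im \o u) y - hartley (Im \o u) (- y)) /\
  Im (fourier u y) = 2^-1 * (hartley (Im \o u) y + hartley (Im \o u) (- y) -
                             hartley (Re \o u) y + hartley (Re \o u) (- y)).
Proof.
move=> /Lcfun1_integrable[a1 b1].
have Hc (f : R -> R) : L1 f -> L1 (fun x => f x * cos (2 * pi * y * x)).
  move=> f1; apply: (integrableMbT f1 (measurable_cosM _)) => x; exact: cos_le1n.
have Hs (f : R -> R) : L1 f -> L1 (fun x => f x * sin (2 * pi * y * x)).
  move=> f1; apply: (integrableMbT f1 (measurable_sinM _)) => x; exact: sin_le1n.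
have E (f : R -> R) : L1 f -> hartley f y =
    \int[mu]_x (f x * cos (2 * pi * y * x)) + \int[mu]_x (f x * sin (2 * pi * y * x)).
  move=> f1; rewrite -RintegralD//; [|exact: Hc|exact: Hs].
  by apply: eq_Rintegral => x _; rewrite hkernelC /hkernel mulrDr.
have EN (f : R -> R) : L1 f -> hartley f (- y) =
    \int[mu]_x (f x * cos (2 * pi * y * x)) - \int[mu]_x (f x * sin (2 * pi * y * x)).
  move=> f1; rewrite -RintegralB//; [|exact: Hc|exact: Hs].
  by apply: eq_Rintegral => x _; rewrite hkernelC /hkernel mulrN mulNr cosN sinN; ring.
have ang x : - (2 * pi * x * y) = - (2 * pi * y * x) by ring.
split.
- transitivity (\int[mu]_x ((Re \o u) x * cos (2 * pi * y * x) +
                            (Im \o u) x * sin (2 * pi * y * x))).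
    by apply: eq_Rintegral => x _; rewrite ReM /cexpi ang cosN sinN /=; ring.
  rewrite RintegralD//; [|exact: Hc|exact: Hs].
  by rewrite !E// !EN//; field.
- transitivity (\int[mu]_x ((Im \o u) x * cos (2 * pi * y * x) -
                            (Re \o u) x * sin (2 * pi * y * x))).
    by apply: eq_Rintegral => x _; rewrite ImM /cexpi ang cosN sinN /=; ring.
  rewrite RintegralB//; [|exact: Hc|exact: Hs].
  by rewrite !E// !EN//; field.
Qed.

(** Inverts the linear system [fourierE], taken at [y] and at [- y]. *)
Lemma hartley_fourier u y : Lcfun 1%:E u ->
  hartley (Re \o u) y = hartley_Re (fourier u) y /\
  hartley (Im \o u) y = hartley_Im (fourier u) y.
Proof.
move=> u1; rewrite /hartley_Re /hartley_Im.
have [-> ->] := fourierE y u1; have [-> ->] := fourierE (- y) u1.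
by rewrite opprK; split; field.
Qed.

Lemma sqint_hartley_ReIm g : sqint mu (Re \o g) -> sqint mu (Im \o g) ->
  sqint mu (hartley_Re g) /\ sqint mu (hartley_Im g).
Proof.
move=> a2 b2; have a2' := sqint_opp a2; have b2' := sqint_opp b2.
split; apply: sqintZ.
  by apply: sqintB => //; apply: sqintD => //; exact: sqintD.
by apply: sqintB => //; apply: sqintD => //; exact: sqintD.
Qed.

Lemma sqint_fourier u : Lcfun 1%:E u -> Lcfun 2%:E u ->
  sqint mu (Re \o fourier u) /\ sqint mu (Im \o fourier u).
Proof.
move=> u1 /Lcfun2_sqint[a2 b2]; have [a1 b1] := Lcfun1_integrable u1.
have [Ha _] := hartley_contraction a1 a2; have [Hb _] := hartley_contraction b1 b2.
have Ha' := sqint_opp Ha; have Hb' := sqint_opp Hb.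
split.
- have -> : Re \o fourier u = fun y => 2^-1 * (hartley (Re \o u) y +
      hartley (Re \o u) (- y) + hartley (Im \o u) y - hartley (Im \o u) (- y)).
    by apply/funext => y; have [] := fourierE y u1.
  by apply: sqintZ; apply: sqintB => //; apply: sqintD => //; exact: sqintD.
- have -> : Im \o fourier u = fun y => 2^-1 * (hartley (Im \o u) y +
      hartley (Im \o u) (- y) - hartley (Re \o u) y + hartley (Re \o u) (- y)).
    by apply/funext => y; have [] := fourierE y u1.
  by apply: sqintZ; apply: sqintD => //; apply: sqintB => //; exact: sqintD.
Qed.

(** The extended L^2 distance is here the square root of the displayed sum, which is finite. *)
Lemma cvg_L2dist (F : nat -> R -> R[i]) g :
  (forall n, sqint mu (Re \o F n) /\ sqint mu (Im \o F n)) ->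
  sqint mu (Re \o g) -> sqint mu (Im \o g) ->
  L2dist (F n) g @[n --> \oo] --> 0%E ->
  \int[mu]_x (Re (F n x) - Re (g x)) ^+ 2 + \int[mu]_x (Im (F n x) - Im (g x)) ^+ 2
    @[n --> \oo] --> 0.
Proof.
move=> F2 gr2 gi2 Fg.
pose N n := \int[mu]_x (Re (F n x) - Re (g x)) ^+ 2 +
            \int[mu]_x (Im (F n x) - Im (g x)) ^+ 2.
have N0 n : 0 <= N n by rewrite addr_ge0 ?Rintegral_sqr_ge0.
have LE n : L2dist (F n) g = (Num.sqrt (N n))%:E.
  have [[_ dr] [_ di]] := (sqintB (F2 n).1 gr2, sqintB (F2 n).2 gi2).
  rewrite /L2dist unlock /= (_ : (\int[mu]_x _)%E = (N n)%:E).
    by rewrite poweR_EFin powR12_sqrt.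
  rewrite /N -RintegralD// EFin_RintegralT; last exact: integrableDT.
  apply: eq_integral => x _.
  rewrite ger0_norm ?normc_ge0// powR_mulrn ?normc_ge0// sqr_normc.
  by case: (F n x) => ? ?; case: (g x).
have sN : Num.sqrt (N n) @[n --> \oo] --> 0.
  rewrite (_ : (fun n => Num.sqrt (N n)) = fine \o (fun n => L2dist (F n) g)).
    exact: fine_cvg.
  by apply/funext => n /=; rewrite LE.
have NE : N = (fun n => Num.sqrt (N n) * Num.sqrt (N n)).
  by apply/funext => n; rewrite -expr2 sqr_sqrtr.
suff : N n @[n --> \oo] --> 0 by [].
by rewrite NE -[X in _ --> X](mul0r 0); exact: cvgM.
Qed.

Lemma cvgr0_squeeze (a b : nat -> R) : (forall n, 0 <= a n <= b n) ->
  b n @[n --> \oo] --> 0 -> a n @[n --> \oo] --> 0.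
Proof.
move=> ab b0; apply: (@squeeze_cvgr _ _ _ _ (cst 0) b) => //.
- exact: nearW.
- exact: cvg_cst.
Qed.

(** The real and imaginary parts of the sequence that witnesses [fourierL2] serve as witnesses. The
    Hartley error at [y] is controlled by the Fourier errors at [y] and [- y], which doubles the
    integral. *)
Lemma hartley_pair_fourierL2 f g : fourierL2 f g ->
  hartley_pair (Re \o f) (hartley_Re g) /\ hartley_pair (Im \o f) (hartley_Im g).
Proof.
move=> [/Lcfun2_sqint[fr fi] /Lcfun2_sqint[gr gi] [u [u12 uf ug]]].
have u2 n := Lcfun2_sqint (u12 n).2.
have u1 n := Lcfun1_integrable (u12 n).1.
have F2 n := sqint_fourier (u12 n).1 (u12 n).2.
have [hr hi] := sqint_hartley_ReIm gr gi.
have cu := cvg_L2dist u2 fr fi uf.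
have cF := cvg_L2dist F2 gr gi ug.
have cF4 : 2 * (\int[mu]_x (Re (fourier (u n) x) - Re (g x)) ^+ 2 +
    \int[mu]_x (Im (fourier (u n) x) - Im (g x)) ^+ 2) @[n --> \oo] --> 0.
  by rewrite -[X in _ --> X](mulr0 2); apply: cvgM => //; exact: cvg_cst.
have bound n (h : R -> R) : measurable_fun setT h ->
    (forall y, h y ^+ 2 <=
      (Re (fourier (u n) y) - Re (g y)) ^+ 2 + (Im (fourier (u n) y) - Im (g y)) ^+ 2 +
      ((Re (fourier (u n) (- y)) - Re (g (- y))) ^+ 2 +
       (Im (fourier (u n) (- y)) - Im (g (- y))) ^+ 2)) ->
    \int[mu]_y h y ^+ 2 <=
    2 * (\int[mu]_x (Re (fourier (u n) x) - Re (g x)) ^+ 2 +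
         \int[mu]_x (Im (fourier (u n) x) - Im (g x)) ^+ 2).
  move=> mh hle.
  have [_ d1] := sqintB (F2 n).1 gr; have [_ d2] := sqintB (F2 n).2 gi.
  have s1 := integrableDT d1 d2; have s2 := integrable_opp s1.
  (* One of the two copies of the error is reflected, to match the terms at [- y]. *)
  rewrite mulr_natl mulr2n -RintegralD// -{2}(Rintegral_opp s1) -RintegralD//.
  have s3 := integrableDT s1 s2.
  apply: le_Rintegral => //; apply: le_integrableT s3.
    exact: measurable_funX.
  by move=> y; rewrite ger0_norm ?sqr_ge0.
split; split => //.
- exists (fun n => Re \o u n); split.
  + by move=> n; split; [case: (u1 n)|case: (u2 n)].
  + apply: cvgr0_squeeze cu => n; rewrite Rintegral_sqr_ge0 /=.
    by rewrite lerDl Rintegral_sqr_ge0.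
  + apply: cvgr0_squeeze cF4 => n; rewrite Rintegral_sqr_ge0 /=.
    apply: bound.
      apply: measurable_funB; last by case: hr.
      by apply: measurable_hartley; case: (u1 n).
    move=> y; have [-> _] := hartley_fourier y (u12 n).1; rewrite /hartley_Re.
    set a := Re (fourier _ y); set b := Im (fourier _ y).
    set a' := Re (fourier _ (- y)); set b' := Im (fourier _ (- y)).
    move: (Re (g y)) (Im (g y)) (Re (g (- y))) (Im (g (- y))) => c d c' d'.
    rewrite (_ : _ - _ = 2^-1 * ((a - c) + (a' - c') + (b' - d') - (b - d))).
      exact: sqr_half_sum_le.
    by ring.
- exists (fun n => Im \o u n); split.
  + by move=> n; split; [case: (u1 n)|case: (u2 n)].
  + apply: cvgr0_squeeze cu => n; rewrite Rintegral_sqr_ge0 /=.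
    by rewrite lerDr Rintegral_sqr_ge0.
  + apply: cvgr0_squeeze cF4 => n; rewrite Rintegral_sqr_ge0 /=.
    apply: bound.
      apply: measurable_funB; last by case: hi.
      by apply: measurable_hartley; case: (u1 n).
    move=> y; have [_ ->] := hartley_fourier y (u12 n).1; rewrite /hartley_Im.
    set a := Re (fourier _ y); set b := Im (fourier _ y).
    set a' := Re (fourier _ (- y)); set b' := Im (fourier _ (- y)).
    move: (Re (g y)) (Im (g y)) (Re (g (- y))) (Im (g (- y))) => c d c' d'.
    rewrite (_ : _ - _ = 2^-1 * ((b - d) + (b' - d') + (a - c) - (a' - c'))).
      apply: (le_trans (sqr_half_sum_le _ _ _ _)).
      by rewrite le_eqVlt; apply/orP; left; apply/eqP; ring.
    by ring.
Qed.

Lemma ae_opp (P : R -> Prop) : {ae mu, forall x, P x} -> {ae mu, forall x, P (- x)}.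
Proof.
move=> [N [mN N0 sN]]; exists (-%R @^-1` N); split.
- by rewrite -[X in measurable X]setTI; exact: oppr_measurable.
- by rewrite -N0 -(lebesgue_measureN mN).
- by move=> x /= nP; exact: sN.
Qed.

(** Turns Hermitian orthonormality into the real orthonormality of pairs used by [bessel_pair]. *)
Lemma Re_cdot (f g : R -> R[i]) : Lcfun 2%:E f -> Lcfun 2%:E g ->
  Re (cdot f g) =
  \int[mu]_x ((Re \o f) x * (Re \o g) x) + \int[mu]_x ((Im \o f) x * (Im \o g) x).
Proof.
move=> /Lcfun2_sqint[fr fi] /Lcfun2_sqint[gr gi].
rewrite -RintegralD//; [|exact: sqintM..].
apply: eq_Rintegral => x _; rewrite ReM /=.
by case: (g x) => c d /=; ring.
Qed.

End complex.

(** * Passage from finite families to arbitrary index types *)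

Lemma card_leNI_inj (T : Type) (n : nat) : ~ ([set: T] #<= `I_n)%card ->
  exists f : 'I_n.+1 -> T, injective f.
Proof.
move=> Tn; have /card_leP[F] : (`I_n.+1 #<= [set: T])%card.
  (* A finite [T] has more than [n] elements by hypothesis; an infinite one contains a copy of
     [nat]. *)
  have [/finite_setP[m]|/infiniteP nT] := pselect (finite_set [set: T]).
    rewrite card_eq_le => /andP[Tm mT]; apply: card_le_trans mT.
    rewrite card_le_II ltnNge; apply/negP => mn; apply: Tn.
    by apply: card_le_trans Tm _; rewrite card_le_II.
  by apply: card_le_trans nT; exact: card_leT.
pose i2 (i : 'I_n.+1) : `I_n.+1 := SigSub (mem_set (ltn_ord i : `I_n.+1 i)).
exists (fun i => val (F (i2 i))) => i j /val_inj.
move=> /(@inj _ _ _ F); rewrite !inE => /(_ I I) /(congr1 val) /= ij.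
exact: val_inj.
Qed.

Theorem mainTheorem3 (R : realType) (phi psi : R -> R)
    (hphi : phi \in Lfun (@lebesgue_measure R) 2%:E)
    (hpsi : psi \in Lfun (@lebesgue_measure R) 2%:E) :
  exists N : nat, forall (I : Type) (e : I -> R -> R[i]),
    (forall k, Lcfun 2%:E (e k)) ->
    orthonormal_family e ->
    (forall k, {ae @lebesgue_measure R, forall x, normc (e k x) <= phi x}) ->
    (forall k, exists2 ek_hat : R -> R[i], fourierL2 (e k) ek_hat &
       {ae @lebesgue_measure R, forall xi, normc (ek_hat xi) <= psi xi}) ->
    [set: I] #<= `I_N.
Proof.
have phi2 := Lfun2_sqint hphi; have psi2 := Lfun2_sqint hpsi.
(* The symmetrised majorant: Hartley transforms at [y] involve the Fourier transform at [y] and at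
   [- y]. *)
have Psi2 := sqintD psi2 (sqint_opp psi2).
have [N HN] := hartley_umbrella phi2 Psi2.
exists N => I e e2 [e1 e0] ephi ehat; apply: contrapT => /card_leNI_inj[f finj].
(* Choice fixes one representative of the transform for each index. *)
have {}ehat k : {ek_hat : R -> R[i] | fourierL2 (e k) ek_hat &
    {ae @lebesgue_measure R, forall xi, normc (ek_hat xi) <= psi xi}}.
  exact/cid2/ehat.
pose F k := s2val (ehat k).
have FE k : fourierL2 (e k) (F k) := s2valP (ehat k).
have Fpsi k : {ae @lebesgue_measure R, forall xi, normc (F k xi) <= psi xi} := s2valP' (ehat k).
have Fsum k : {ae @lebesgue_measure R,
    forall xi, normc (F k xi) + normc (F k (- xi)) <= psi xi + psi (- xi)}.
  apply: (@filterS2 _ _ (ae_filter_ringOfSetsType lebesgue_measure)) (Fpsi k) (ae_opp (Fpsi k)) => x.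
  exact: lerD.
(* Applied to [N.+1] distinct indices, the finite bound is absurd. *)
have := HN N.+1 (fun i => @complex.Re R \o e (f i)) (fun i => @complex.Im R \o e (f i))
  (fun i => hartley_Re (F (f i))) (fun i => hartley_Im (F (f i))) _ _ _ _ _ _.
rewrite ltnn => H; suff : false by []; apply: H.
- by move=> i; have [] := hartley_pair_fourierL2 (FE (f i)).
- by move=> i; have [] := hartley_pair_fourierL2 (FE (f i)).
- move=> i j; rewrite -Re_cdot//; have [->|ij] := eqVneq i j; first by rewrite e1.
  by rewrite e0// => /finj ij'; rewrite ij' eqxx in ij.
- move=> i; apply: (@filterS _ _ (ae_filter_ringOfSetsType lebesgue_measure)) (ephi (f i)) => x ex.
  by rewrite /= -sqr_normc lerXn2r ?nnegrE ?normc_ge0// (le_trans (normc_ge0 _) ex).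
- move=> i; apply: (@filterS _ _ (ae_filter_ringOfSetsType lebesgue_measure)) (Fsum (f i)) => y.
  exact/le_trans/hartley_Re_le.
- move=> i; apply: (@filterS _ _ (ae_filter_ringOfSetsType lebesgue_measure)) (Fsum (f i)) => y.
  exact/le_trans/hartley_Im_le.
Qed.
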